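(* Let $E$ be a separable Hilbert space. For $\xi\in H^\infty(\mathbb{D},E)$, let $C_\xi:H^2(\mathbb{D},E)\to H^2(\mathbb{D},\wedge^2E)$ be the pointwise creation operator $C_\xi f=\xi\,\dot\wedge\, f$. Then $$\ker C_\xi\subset \mathrm{PLS}(\{\xi\},H^2(\mathbb{D},E)).$$
   Context: $\mathbb{D}$ is the open unit disc and $\mathbb{T}$ the unit circle. Hilbert spaces are complex. Wedge products: for a Hilbert space $E$, $\otimes_H^2E$ is the completion of the algebraic tensor square of $E$ for the norm induced by the inner product $\langle x_1\otimes x_2,\,y_1\otimes y_2\rangle=2\langle x_1,y_1\rangle_E\langle x_2,y_2\rangle_E$ (note the factor $2=2!$). $\wedge^2E$ is the closed subspace of antisymmetric tensors (those changing sign under the unitary flip $x\otimes y\mapsto y\otimes x$), with the inherited inner product, and $x\wedge y$ is the orthogonal projection of $x\otimes y$ onto $\wedge^2E$. The pointwise wedge product is $(\xi\,\dot\wedge\, f)(z)=\xi(z)\wedge f(z)$ for $z\in\mathbb{D}$. $H^\infty(\mathbb{D},E)$ is the space of bounded analytic $E$-valued functions on $\mathbb{D}$. $H^2(\mathbb{D},E)$ is the space of analytic $f:\mathbb{D}\to E$ with $\sup_{0<r<1}\left(\frac1{2\pi}\int_0^{2\pi}\|f(re^{i\theta})\|_E^2\,d\theta\right)^{1/2}<\infty$. Functions in these spaces have radial limits in the norm of $E$ almost everywhere on $\mathbb{T}$, denoted by the same letter; via radial limits, $H^2(\mathbb{D},E)$ is identified with a closed subspace of $L^2(\mathbb{T},E)$.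 For a subspace $F$ of $L^2(\mathbb{T},E)$ and a subset $X$ of $L^2(\mathbb{T},E)$, the pointwise linear span of $X$ in $F$ is $\mathrm{PLS}(X,F)=\{f\in F: f(z)\in\mathrm{span}\{x(z):x\in X\}\text{ for almost all }z\in\mathbb{T}\}$.
   Formalization: The formal statement assumes that ξ is not identically zero on the disc; for ξ = 0 the claim fails (E = ℂ, f = 1 lies in ker C_ξ = H², while PLS({0}, H²) = {0}). *)

(* Defs.v *)
From mathcomp Require Import all_boot all_order all_algebra.
From mathcomp Require Import complex.
From mathcomp Require Import all_classical all_reals all_analysis.

Set Implicit Arguments.
Unset Strict Implicit.
Unset Printing Implicit Defensive.

Import Order.TTheory GRing.Theory Num.Theory.
Import numFieldNormedType.Exports.

Local Open Scope classical_set_scope.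
Local Open Scope complex_scope.
Local Open Scope ring_scope.

(* A {dot _ for Num.conj} is linear in its first argument and conjugate-linear
   in its second one; hilbert_normE says that it induces the complete norm.
   Norms over R[i] take their values in R[i]; see rnorm. *)
Record hilbertType (R : realType) := HilbertType {
  hilbert_space :> completeNormedModType R[i];
  hilbert_dot : {dot hilbert_space for Num.conj};
  hilbert_normE : forall x : hilbert_space, `|x| ^+ 2 = hilbert_dot x x
}.

Notation "''[' x , y ]" := (hilbert_dot _ x y) : ring_scope.

Definition rnorm (R : realType) (E : normedModType R[i]) (x : E) : R :=
  complex.Re `|x|.

Definition separable (T : topologicalType) :=
  exists2 S : set T, countable S & dense S.

Definition lspan (K : pzRingType) (V : lmodType K) (A : set V) : set V :=
  [set v | exists n (c : 'I_n -> K) (a : 'I_n -> V),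
     (forall i, A (a i)) /\ v = \sum_(i < n) c i *: a i].

(* A completion of the algebraic tensor square of E for the inner product
   <x1 (x) x2, y1 (x) y2> = 2 <x1, y1> <x2, y2>: since tens_dot fixes the inner
   product on sums of elementary tensors, these form an isometric copy of the
   algebraic tensor square, which tens_dense makes dense in the complete space.
   Hence such a structure is unique up to a unitary compatible with tens, and
   tens_flip is the unique unitary exchanging the two factors. *)
Record tensorSquare (R : realType) (E : hilbertType R) := TensorSquare {
  tsq_space :> hilbertType R;
  tens : E -> E -> tsq_space;
  tens_linearl : forall y, linear (tens ^~ y);
  tens_linearr : forall x, linear (tens x);
  tens_dot : forall x1 x2 y1 y2 : E,
    '[tens x1 x2, tens y1 y2] = 2%:R * '[x1, y1] * '[x2, y2];
  tens_dense : dense (lspan [set tens p.1 p.2 | p in [set: E * E]]);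
  tens_flip : {linear tsq_space -> tsq_space};
  tens_flip_bij : bijective tens_flip;
  tens_flip_dot : forall u v : tsq_space,
    '[tens_flip u, tens_flip v] = '[u, v];
  tens_flipE : forall x y : E, tens_flip (tens x y) = tens y x
}.
Arguments tens {R E} t x y.
Arguments tens_flip {R E} t.

Section Wedge.
Variables (R : realType) (E : hilbertType R) (T : tensorSquare E).

Definition wedge2 : set T := [set u | tens_flip T u = - u].

(* the default value 0 is only reached when u has no projection on V *)
Definition orth_proj (H : hilbertType R) (V : set H) (u : H) : H :=
  xget 0 [set p | V p /\ forall v, V v -> '[u - p, v] = 0].

Definition wedge (x y : E) : T := orth_proj wedge2 (tens T x y).

Definition pointwise_wedge (xi f : R[i] -> E) : R[i] -> T :=
  fun z => wedge (xi z) (f z).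

End Wedge.

(* Functions on the disc and on the circle are represented by functions on the
   whole of R[i] whose values elsewhere are irrelevant. *)
Definition disc (R : realType) : set R[i] := [set z | `|z| < 1].

Definition cis (R : realType) (t : R) : R[i] := cos t +i* sin t.

Definition ae_circle (R : realType) (P : R[i] -> Prop) : Prop :=
  {ae @lebesgue_measure R, forall t, t \in `[0, 2 * pi] -> P (cis t)}.

Section Hardy.
Variables (R : realType) (E : hilbertType R).
Implicit Types f g xi : R[i] -> E.

(* local expansion in a norm convergent power series at every point *)
Definition analytic_on (D : set R[i]) f : Prop :=
  forall z0, D z0 -> exists a : nat -> E, exists2 e : R, 0 < e &
    forall z, `|z - z0| < e%:C ->
      series (fun n => (z - z0) ^+ n *: a n) @ \oo --> f z.

Definition Hinfty : set (R[i] -> E) :=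
  [set f | analytic_on (@disc R) f /\
           exists M : R, forall z, disc z -> rnorm (f z) <= M].

Definition mean2 f (r : R) : \bar R :=
  (((2 * pi)^-1)%:E *
     \int[@lebesgue_measure R]_(t in `[0%R, (2 * pi)%R])
        (rnorm (f (r%:C%C * cis t)) ^+ 2)%:E) `^ 2^-1.

Definition H2 : set (R[i] -> E) :=
  [set f | analytic_on (@disc R) f /\
           (ereal_sup [set mean2 f r | r in `]0%R, 1%R[] < +oo)%E].

(* meaningful at the points of the circle where the radial limit exists *)
Definition radial_lim f : R[i] -> E :=
  fun z => lim (f (r%:C * z) @[r --> (1 : R)^'-]).

(* H2, viewed as a space of (a.e. classes of) functions on the circle *)
Definition H2_circle : set (R[i] -> E) :=
  [set g | exists2 f, H2 f &
     ae_circle (fun z => f (r%:C * z) @[r --> (1 : R)^'-] --> g z)].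

Definition PLS (X F : set (R[i] -> E)) : set (R[i] -> E) :=
  [set f | F f /\ ae_circle (fun z => lspan [set x z | x in X] (f z))].

Definition creation_ker (T : tensorSquare E) xi : set (R[i] -> E) :=
  [set f | H2 f /\ forall z, disc z -> pointwise_wedge T xi f z = 0].

End Hardy.
Arguments H2_circle {R} E.

(* Main.v *)
Require Import Defs.
From HB Require Import structures.
From mathcomp Require Import all_boot all_order all_algebra.
From mathcomp Require Import complex.
From mathcomp Require Import all_classical all_reals all_analysis.
From mathcomp Require Import measurable_realfun ring lra.

(** At a point z of the disc, the wedge product of xi z and f z vanishes exactly
    when the Cauchy-Schwarz inequality for these two vectors is an equality,
    that is when |xi z|^2 f z = <f z, xi z> xi z (wedge0_parallel). This
    relation passes to radial limits wherever both functions have one. At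
    almost every point of the circle the limits exist, and that of xi is not
    zero; dividing by its square norm exhibits the boundary value of f as a
    multiple of the one of xi. So the proof consists of two theorems on
    boundary values: radial limits of Hilbert space valued H^2 functions exist
    almost everywhere in norm (fatou), and bounded scalar holomorphic functions
    that do not vanish identically have almost everywhere a nonzero radial
    limit, if any (radial_nonzero), which is applied to z |-> <xi z, xi z0>.

    Both rest on integrals over circles of scalar functions. An analytic
    function is used through its difference quotient, which is jointly
    continuous (hol, analytic_hol). A mean over a circle that depends on a
    parameter is constant as soon as its derivative in the parameter is an
    angular derivative (circ_const, circ_deriv). This gives Cauchy's formula
    (circ_cauchy), hence the domination of |f| by Poisson integrals
    (poisson_ineq_hilbert), and it shows that the mean of <f(r z), f(s z)> over
    |z| = 1 depends on r s only (corr_scale). By the latter, the mean square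
    of f on circles is convex in log r, therefore increasing, and the circles
    form a Cauchy family in mean square (circ_dist_small).

    For the existence of radial limits, the Poisson kernel is cut into dyadic
    pieces, so that the Hardy-Littlewood maximal inequality yields a weak type
    estimate for the supremum of |f| along radii (weak_type). Applied to the
    difference of f and a dilate f(rho z), which is small in the mean while
    the dilate is continuous up to the circle, it shows that f oscillates along
    almost no radius (oscillating_null).

    For the nonvanishing, let V be a compact set of positive measure on which
    the radial limit of a bounded holomorphic function h is zero. The Herglotz
    integral w of V has 0 <= Re w <= 1, with radial limit of Re w zero off V.
    The function q = (2 + w) / (2 - w) is then bounded, has boundary modulus 1
    off V, and modulus larger than 1 inside the disc. The functions h q^m are
    thus bounded on the circle independently of m, while their value at a point
    where h does not vanish is unbounded in m: a contradiction
    (compact_zeros_null). *)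

Set Implicit Arguments.
Unset Strict Implicit.
Unset Printing Implicit Defensive.

Import Order.TTheory GRing.Theory Num.Theory.
Import numFieldNormedType.Exports.

Local Open Scope classical_set_scope.
Local Open Scope complex_scope.
Local Open Scope ring_scope.

Local Notation Re := complex.Re.
Local Notation Im := complex.Im.

(** * Complex numbers, norms and inner products *)

(* Gives the complex numbers a topology under their own name, so that limits of
   functions with values in R[i] can be taken. *)
HB.instance Definition _ (R : realType) := NormedModule.copy R[i] R[i]^o.

Section ComplexBasics.
Variable R : realType.
Implicit Types (z w : R[i]) (r s : R).

Lemma Re_add z w : Re (z + w) = Re z + Re w.
Proof. by case: z w => a b []. Qed.

Lemma Re_opp z : Re (- z) = - Re z.
Proof. by case: z. Qed.

Lemma Re_sub z w : Re (z - w) = Re z - Re w.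
Proof. by rewrite Re_add Re_opp. Qed.

Lemma Im_add z w : Im (z + w) = Im z + Im w.
Proof. by case: z w => a b []. Qed.

Lemma Im_opp z : Im (- z) = - Im z.
Proof. by case: z. Qed.

Lemma Im_sub z w : Im (z - w) = Im z - Im w.
Proof. by rewrite Im_add Im_opp. Qed.

Lemma Re_mul z w : Re (z * w) = Re z * Re w - Im z * Im w.
Proof. by case: z w => a b []. Qed.

Lemma Im_mul z w : Im (z * w) = Re z * Im w + Im z * Re w.
Proof. by case: z w => a b []. Qed.

Lemma Re_scale r z : Re (r%:C * z) = r * Re z.
Proof. by rewrite Re_mul /= mul0r subr0. Qed.

Lemma Im_scale r z : Im (r%:C * z) = r * Im z.
Proof. by rewrite Im_mul /= mul0r addr0. Qed.

Lemma complex_ext z w : Re z = Re w -> Im z = Im w -> z = w.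
Proof. by case: z w => a b [c d] /= -> ->. Qed.

Lemma real_complexD r s : (r + s)%:C = r%:C + s%:C.
Proof. exact: rmorphD. Qed.

Lemma real_complexM r s : (r * s)%:C = r%:C * s%:C.
Proof. exact: rmorphM. Qed.

Lemma real_complexB r s : (r - s)%:C = r%:C - s%:C.
Proof. exact: rmorphB. Qed.

Lemma real_complexX r n : (r ^+ n)%:C = r%:C ^+ n.
Proof. exact: rmorphXn. Qed.

Lemma real_complexV r : (r^-1)%:C = (r%:C)^-1.
Proof. exact: fmorphV. Qed.

Lemma rnormE (V : normedModType R[i]) (x : V) : `|x| = (rnorm x)%:C.
Proof.
rewrite /rnorm; apply: complex_ext => //=.
by apply: ger0_Im; exact: normr_ge0.
Qed.

Section Rnorm.
Variable V : normedModType R[i].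
Implicit Types x y : V.

Lemma rnorm_ge0 x : 0 <= rnorm x.
Proof. by rewrite -lecR -rnormE normr_ge0. Qed.

Lemma rnorm0 : rnorm (0 : V) = 0.
Proof. by rewrite /rnorm normr0. Qed.

Lemma rnorm0_eq0 x : rnorm x = 0 -> x = 0.
Proof. by move=> x0; apply/normr0_eq0; rewrite rnormE x0. Qed.

Lemma rnorm_gt0 x : x <> 0 -> 0 < rnorm x.
Proof.
move=> x0; rewrite lt_neqAle rnorm_ge0 andbT eq_sym.
by apply/eqP => /rnorm0_eq0.
Qed.

Lemma rnormD x y : rnorm (x + y) <= rnorm x + rnorm y.
Proof. by rewrite -lecR real_complexD -!rnormE; exact: ler_normD. Qed.

Lemma rnormN x : rnorm (- x) = rnorm x.
Proof. by rewrite /rnorm normrN. Qed.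

Lemma rnormC x y : rnorm (x - y) = rnorm (y - x).
Proof. by rewrite -rnormN opprB. Qed.

Lemma rnormB x y : rnorm (x - y) <= rnorm x + rnorm y.
Proof. by rewrite (le_trans (rnormD _ _))// rnormN. Qed.

Lemma rnorm_dist x y : `|rnorm x - rnorm y| <= rnorm (x - y).
Proof.
rewrite ler_norml; apply/andP; split.
  rewrite -subr_ge0 opprK addrAC subr_ge0 rnormC.
  by rewrite -{1}[y](subrK x) addrC rnormD.
by rewrite lerBlDr -{1}[x](subrK y) rnormD.
Qed.

Lemma rnormZ z x : rnorm (z *: x) = rnorm z * rnorm x.
Proof. by apply: complexI; rewrite real_complexM -!rnormE normrZ. Qed.

Lemma rnorm_trans x y (w : V) : rnorm (x - y) <= rnorm (x - w) + rnorm (w - y).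
Proof. by rewrite -{1}(subrK w x) -addrA rnormD. Qed.

Lemma cvg_rnormP (T : Type) (F : set_system T) (FF : Filter F) (f : T -> V) l :
  f @ F --> l <-> (forall e : R, 0 < e -> \forall x \near F, rnorm (f x - l) < e).
Proof.
split=> [/cvgrPdistC_lt fl e e0|fl].
  have := fl e%:C; rewrite ltcR => /(_ e0); apply: filterS => x.
  by rewrite rnormE ltcR.
apply/cvgrPdistC_lt => e e0.
have /complex_realP[r er] : e \is Num.real by apply: gtr0_real.
move: e0; rewrite {}er ltcR => /fl; apply: filterS => x.
by rewrite rnormE ltcR.
Qed.

Lemma cvg_rnorm_squeeze (T : Type) (F : set_system T) (FF : Filter F)
    (f : T -> V) l (g : T -> R) :
  (\forall x \near F, rnorm (f x - l) <= g x) -> g @ F --> (0 : R) -> f @ F --> l.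
Proof.
move=> fg /cvgrPdistC_lt g0; apply/cvg_rnormP => e e0.
have := g0 _ e0; apply: filterS2 fg => x fg.
by rewrite subr0 => /ltr_normlW; exact: le_lt_trans.
Qed.

Lemma cvg_rnorm (T : Type) (F : set_system T) (FF : Filter F) (f : T -> V) l :
  f @ F --> l -> rnorm (f x) @[x --> F] --> rnorm l.
Proof.
move=> /cvg_rnormP fl; apply/cvgrPdistC_lt => e /fl; apply: filterS => x.
by move=> /=; apply: le_lt_trans; exact: rnorm_dist.
Qed.

End Rnorm.

Lemma rnormM z w : rnorm (z * w) = rnorm z * rnorm w.
Proof. exact: rnormZ. Qed.

Lemma rnorm1 : rnorm (1 : R[i]) = 1.
Proof. by rewrite /rnorm normr1. Qed.

Lemma rnormX z n : rnorm (z ^+ n) = rnorm z ^+ n.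
Proof.
by elim: n => [|n ih]; rewrite ?expr0 ?rnorm1// !exprS rnormM ih.
Qed.

Lemma rnormV z : rnorm z^-1 = (rnorm z)^-1.
Proof.
by apply: complexI; rewrite -rnormE normfV rnormE real_complexV.
Qed.

Lemma rnorm_sqr z : rnorm z ^+ 2 = Re z ^+ 2 + Im z ^+ 2.
Proof. by apply: complexI; rewrite real_complexX -rnormE add_Re2_Im2. Qed.

Lemma rnormR r : rnorm r%:C = `|r|.
Proof.
apply/eqP; rewrite -(eqrXn2 (n := 2))// ?rnorm_ge0//.
by rewrite rnorm_sqr/= expr0n addr0 real_normK ?num_real.
Qed.

Lemma rnormJ z : rnorm (conjc z) = rnorm z.
Proof. by rewrite /rnorm normcJ. Qed.

Lemma ler_Re_rnorm z : `|Re z| <= rnorm z.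
Proof. by rewrite -lecR -rnormE normc_ge_Re. Qed.

Lemma Re_le_rnorm z : Re z <= rnorm z.
Proof. exact: le_trans (ler_norm _) (ler_Re_rnorm z). Qed.

Lemma ler_Im_rnorm z : `|Im z| <= rnorm z.
Proof.
rewrite -(ler_pXn2r (n := 2)) ?nnegrE ?rnorm_ge0// rnorm_sqr.
by rewrite real_normK ?num_real// lerDr sqr_ge0.
Qed.

Lemma conjcM z w : conjc (z * w) = conjc z * conjc w.
Proof. exact: rmorphM. Qed.

Lemma conjcB z w : conjc (z - w) = conjc z - conjc w.
Proof. exact: rmorphB. Qed.

Lemma conjcV z : conjc z^-1 = (conjc z)^-1.
Proof. exact: fmorphV. Qed.

Lemma mul_conjc z : z * conjc z = (rnorm z ^+ 2)%:C.
Proof. by rewrite -sqr_normc rnormE real_complexX. Qed.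

Lemma rnorm_le_ReIm z : rnorm z <= `|Re z| + `|Im z|.
Proof.
rewrite -(ler_pXn2r (n := 2)) ?nnegrE ?rnorm_ge0 ?addr_ge0// rnorm_sqr.
rewrite -[Re z ^+ 2]real_normK ?num_real// -[Im z ^+ 2]real_normK ?num_real//.
have := normr_ge0 (Re z); have := normr_ge0 (Im z); nra.
Qed.

Lemma cvg_Re (T : Type) (F : set_system T) (FF : Filter F) (f : T -> R[i]) l :
  f @ F --> l -> Re (f x) @[x --> F] --> Re l.
Proof.
move=> /cvg_rnormP fl; apply/cvgrPdistC_lt => e /fl; apply: filterS => x.
by apply: le_lt_trans; rewrite -Re_sub ler_Re_rnorm.
Qed.

Lemma cvg_Im (T : Type) (F : set_system T) (FF : Filter F) (f : T -> R[i]) l :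
  f @ F --> l -> Im (f x) @[x --> F] --> Im l.
Proof.
move=> /cvg_rnormP fl; apply/cvgrPdistC_lt => e /fl; apply: filterS => x.
by apply: le_lt_trans; rewrite -Im_sub ler_Im_rnorm.
Qed.

Lemma cvg_ReIm (T : Type) (F : set_system T) (FF : Filter F) (f : T -> R[i]) l :
  Re (f x) @[x --> F] --> Re l -> Im (f x) @[x --> F] --> Im l -> f @ F --> l.
Proof.
move=> fr fi.
apply: (@cvg_rnorm_squeeze _ _ _ _ _ _
  (fun x => `|Re (f x) - Re l| + `|Im (f x) - Im l|)).
  by near=> x; rewrite -Re_sub -Im_sub; exact: rnorm_le_ReIm.
rewrite -[X in _ --> X](addr0 (0 : R)); apply: cvgD.
  by rewrite -(normr0 R) -(subrr (Re l)); apply: cvg_norm; apply: cvgB => //; exact: cvg_cst.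
by rewrite -(normr0 R) -(subrr (Im l)); apply: cvg_norm; apply: cvgB => //; exact: cvg_cst.
Unshelve. all: by end_near. Qed.

Lemma continuous_real_complex : continuous (real_complex R : R -> R[i]).
Proof. by move=> x; apply: cvg_ReIm; [exact: cvg_id|exact: cvg_cst]. Qed.

Lemma rnorm_cis r : rnorm (cis r) = 1.
Proof.
apply/eqP; rewrite -(eqrXn2 (n := 2))// ?rnorm_ge0// rnorm_sqr/= expr1n.
by rewrite cos2Dsin2.
Qed.

Lemma continuous_cis : continuous (@cis R : R -> R[i]).
Proof.
move=> t; apply: cvg_ReIm => /=; first exact: continuous_cos.
exact: continuous_sin.
Qed.

Lemma cis_neq0 r : cis r != 0.
Proof.
by apply/eqP => r0; have := rnorm_cis r; rewrite r0 rnorm0 => /esym/eqP; rewrite oner_eq0.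
Qed.

Lemma conjc_cis r : conjc (cis r) = (cis r)^-1.
Proof.
apply: (mulfI (cis_neq0 r)); rewrite mulfV ?cis_neq0// mul_conjc rnorm_cis.
by rewrite expr1n.
Qed.

Lemma cis_2pi : cis (2 * pi) = cis 0 :> R[i].
Proof.
by rewrite /cis -(add0r (2 * pi)) mulr_natl sinD2pi cosD2pi.
Qed.

Lemma discE z : disc z <-> rnorm z < 1.
Proof. by rewrite /disc /= rnormE -ltcR. Qed.

Lemma disc_cis (r t : R) : 0 <= r -> r < 1 -> disc (r%:C * cis t).
Proof. by move=> r0 r1; apply/discE; rewrite rnormM rnormR rnorm_cis mulr1 ger0_norm. Qed.

Lemma ex_invS_lt (e : R) : 0 < e -> exists n : nat, n.+1%:R^-1 < e.
Proof.
move=> e0; exists (Num.bound e^-1).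
rewrite -[ltRHS]invrK ltf_pV2 ?posrE ?invr_gt0//.
apply: lt_trans (archi_boundP _) _; first by rewrite invr_ge0 ltW.
by rewrite ltr_nat.
Qed.

End ComplexBasics.

Section HilbertBasics.
Variables (R : realType) (E : hilbertType R).
Implicit Types (x y : E) (a : R[i]).

Lemma dotZl a x y : '[a *: x, y] = a * '[x, y].
Proof. by rewrite linearZl_LR. Qed.

Lemma dotZr a x y : '[x, a *: y] = conjc a * '[x, y].
Proof. by rewrite linearZr_LR. Qed.

Lemma dotC x y : '[y, x] = conjc '[x, y].
Proof. by rewrite hermC expr0 mul1r. Qed.

Lemma dotBl x x' y : '[x - x', y] = '[x, y] - '[x', y].
Proof. by rewrite linearBl. Qed.

Lemma dotBr x y y' : '[x, y - y'] = '[x, y] - '[x, y'].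
Proof. by rewrite linearBr. Qed.

Lemma dot0l y : '[0, y] = 0 :> R[i].
Proof. by rewrite linear0l. Qed.

Lemma dotxx x : '[x, x] = (rnorm x ^+ 2)%:C.
Proof. by rewrite -hilbert_normE rnormE real_complexX. Qed.

Lemma rnormB_sqr x y :
  rnorm (x - y) ^+ 2 = rnorm x ^+ 2 + rnorm y ^+ 2 - 2 * Re '[x, y].
Proof.
apply: complexI; rewrite -dotxx dotBl !dotBr (dotC x y) !dotxx.
apply: complex_ext; last by rewrite ?(Im_add, Im_opp, Im_sub) /=; case: '[x, y] => a b /=; ring.
by rewrite ?(Re_add, Re_opp, Re_sub) /=; case: '[x, y] => a b /=; ring.
Qed.

(** The defect in the Cauchy-Schwarz inequality is the square norm of the
    component of y that is orthogonal to x. *)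
Lemma cauchy_schwarz_defect x y :
  rnorm ((rnorm x ^+ 2)%:C *: y - '[y, x] *: x) ^+ 2
  = rnorm x ^+ 2 * (rnorm x ^+ 2 * rnorm y ^+ 2 - rnorm '[x, y] ^+ 2).
Proof.
rewrite rnormB_sqr !rnormZ dotZl dotZr (dotC x y) conjcK rnormJ.
rewrite -dotC Re_scale (dotC x y) mul_conjc rnormR ger0_norm ?exprn_ge0 ?rnorm_ge0//=.
ring.
Qed.

Lemma cauchy_schwarz x y : rnorm '[x, y] <= rnorm x * rnorm y.
Proof.
have [->|x0] := pselect (x = 0); first by rewrite dot0l !rnorm0 mul0r.
rewrite -(ler_pXn2r (n := 2)) ?nnegrE ?mulr_ge0 ?rnorm_ge0//.
rewrite exprMn -subr_ge0 -(pmulr_rge0 _ (exprn_gt0 2 (rnorm_gt0 x0))).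
by rewrite -cauchy_schwarz_defect sqr_ge0.
Qed.

Lemma cvg_dot (T : Type) (F : set_system T) (FF : Filter F) (f g : T -> E) x y :
  f @ F --> x -> g @ F --> y -> '[f z, g z] @[z --> F] --> '[x, y].
Proof.
move=> fx gy; apply: (@cvg_rnorm_squeeze _ _ _ _ _ _ _
  (fun z => rnorm (f z - x) * rnorm (g z) + rnorm x * rnorm (g z - y))).
  near=> z.
  rewrite (_ : _ - _ = '[f z - x, g z] + '[x, g z - y]); last first.
    by rewrite dotBl dotBr; ring.
  by rewrite (le_trans (rnormD _ _))// lerD// cauchy_schwarz.
have h0 (h : T -> E) l : h @ F --> l -> rnorm (h z - l) @[z --> F] --> (0 : R).
  move=> hl; rewrite -(rnorm0 E) -(subrr l).
  by apply: (@cvg_rnorm _ _ _ F); apply: cvgB => //; exact: cvg_cst.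
rewrite [X in _ --> X](_ : _ = 0 * rnorm y + rnorm x * 0); last by ring.
apply: cvgD; apply: cvgM; [exact: h0|exact: cvg_rnorm|exact: cvg_cst|exact: h0].
Unshelve. all: by end_near. Qed.

End HilbertBasics.

(** * Holomorphic functions *)

Section Holomorphic.
Variables (R : realType).
Local Notation C := R[i].

(** Complex differentiability in the form of Caratheodory: the difference
    quotient Q is a function of both points that is continuous on the
    diagonal, where it is the derivative. Sums, products, quotients and
    compositions are then treated by the algebra of limits, and the joint
    continuity is what makes difference quotients converge uniformly on
    circles. The radius r varies because the kernels 1 / (rho ^ 2 - conj a z)
    are holomorphic only slightly beyond the circle of radius rho. *)
Definition hol (V : normedModType C) (r : R) (f : C -> V) (Q : C -> C -> V) : Prop :=
  (forall z w, rnorm z < r -> rnorm w < r -> f z - f w = (z - w) *: Q z w) /\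
  (forall z, rnorm z < r -> Q p.1 p.2 @[p --> (z, z)] --> Q z z).

Section HolCvg.
Variables (V : normedModType C) (r : R) (f : C -> V) (Q : C -> C -> V).
Hypothesis holf : hol r f Q.

Lemma hol_cvgQ (T : Type) (F : set_system T) (FF : Filter F) (u v : T -> C) z :
  rnorm z < r -> u @ F --> z -> v @ F --> z -> Q (u t) (v t) @[t --> F] --> Q z z.
Proof.
move=> dz uz vz.
exact: (cvg_comp _ _ (cvg_pair uz vz) (holf.2 z dz)).
Qed.

Lemma near_rnorm_lt (T : Type) (F : set_system T) (FF : Filter F) (u : T -> C) z :
  rnorm z < r -> u @ F --> z -> \forall t \near F, rnorm (u t) < r.
Proof.
move=> dz /cvg_rnormP uz.
have := uz (r - rnorm z); rewrite subr_gt0 => /(_ dz); apply: filterS => t tz.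
have := rnormD (u t - z) z; rewrite subrK; lra.
Qed.

Lemma hol_cvg (T : Type) (F : set_system T) (FF : Filter F) (u : T -> C) z :
  rnorm z < r -> u @ F --> z -> f (u t) @[t --> F] --> f z.
Proof.
move=> dz uz.
have du := near_rnorm_lt FF dz uz.
suff : (f z + (u t - z) *: Q (u t) z) @[t --> F] --> f z.
  apply: cvg_trans; apply: near_eq_cvg; apply: filterS du => t dut.
  by rewrite -holf.1//; rewrite addrC subrK.
rewrite -[X in _ --> X]addr0 -(scale0r (Q z z)) -(subrr z).
apply: cvgD; first exact: cvg_cst.
apply: cvgZ; last by apply: hol_cvgQ => //; exact: cvg_cst.
by apply: cvgB => //; exact: cvg_cst.
Qed.

End HolCvg.

Lemma hol_cst (V : normedModType C) r (c : V) : hol r (fun=> c) (fun _ _ => 0).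
Proof. by split=> [z w _ _|z _]; [rewrite subrr scaler0|exact: cvg_cst]. Qed.

Lemma hol_id r : hol (V := C) r id (fun _ _ => 1).
Proof. by split=> [z w _ _|z _]; [rewrite /GRing.scale/= mulr1|exact: cvg_cst]. Qed.

Lemma cvg_fst_diag (z : C) : (p.1 : C) @[p --> (z, z)] --> z.
Proof. exact: cvg_fst. Qed.

Lemma cvg_snd_diag (z : C) : (p.2 : C) @[p --> (z, z)] --> z.
Proof. exact: cvg_snd. Qed.

Lemma hol_cvg_fst (V : normedModType C) r (f : C -> V) Q z :
  hol r f Q -> rnorm z < r -> f p.1 @[p --> (z, z)] --> f z.
Proof. by move=> hf dz; apply: (hol_cvg hf) => //; exact: cvg_fst_diag. Qed.

Lemma hol_cvg_snd (V : normedModType C) r (f : C -> V) Q z :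
  hol r f Q -> rnorm z < r -> f p.2 @[p --> (z, z)] --> f z.
Proof. by move=> hf dz; apply: (hol_cvg hf) => //; exact: cvg_snd_diag. Qed.

Lemma hol_add r (f g : C -> C) Q P : hol r f Q -> hol r g P ->
  hol r (fun z => f z + g z) (fun z w => Q z w + P z w).
Proof.
move=> hf hg; split=> [z w dz dw|z dz].
  by rewrite scalerDr -hf.1// -hg.1//; ring.
by apply: cvgD; [exact: hf.2|exact: hg.2].
Qed.

Lemma hol_mul r (f g : C -> C) Q P : hol r f Q -> hol r g P ->
  hol r (fun z => f z * g z) (fun z w => Q z w * g z + f w * P z w).
Proof.
move=> hf hg; split=> [z w dz dw|z dz].
  rewrite /GRing.scale/= mulrDr mulrA -[(z - w) * Q z w](hf.1 z w dz dw).
  by rewrite mulrCA -[(z - w) * P z w](hg.1 z w dz dw); ring.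
apply: cvgD; apply: cvgM.
- exact: hf.2.
- exact: (hol_cvg_fst hg dz).
- exact: (hol_cvg_snd hf dz).
- exact: hg.2.
Qed.

Lemma hol_inv r (f : C -> C) Q : hol r f Q -> (forall z, rnorm z < r -> f z != 0) ->
  hol r (fun z => (f z)^-1) (fun z w => - (Q z w / (f z * f w))).
Proof.
move=> hf f0; split=> [z w dz dw|z dz].
  rewrite /GRing.scale/= mulrN mulrA -[(z - w) * Q z w](hf.1 z w dz dw).
  by field; rewrite !f0.
apply: cvgN; apply: cvgM; first exact: hf.2.
apply: cvgV; first by rewrite mulf_neq0 ?f0.
apply: cvgM; first exact: (hol_cvg_fst hf dz).
exact: (hol_cvg_snd hf dz).
Qed.

Lemma hol_exp r (f : C -> C) Q n : hol r f Q ->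
  exists P, hol r (fun z => f z ^+ n) P.
Proof.
move=> hf; elim: n => [|n [P ih]].
  by exists (fun _ _ => 0); exact: hol_cst.
exists (fun z w => Q z w * f z ^+ n + f w * P z w).
by under eq_fun do rewrite exprS; exact: hol_mul.
Qed.

Lemma hol_dot (E : hilbertType R) r (f : C -> E) Q e : hol r f Q ->
  hol (V := C) r (fun z => '[f z, e]) (fun z w => '[Q z w, e]).
Proof.
move=> hf; split=> [z w dz dw|z dz].
  by rewrite /GRing.scale/= -dotZl -hf.1// dotBl.
apply: cvg_dot; [exact: hf.2|exact: cvg_cst].
Qed.

Lemma hol_le (V : normedModType C) r s (f : C -> V) Q : s <= r ->
  hol r f Q -> hol s f Q.
Proof.
move=> sr [h1 h2]; split=> [z w zs ws|z zs].
  by apply: h1; [apply: lt_le_trans zs _|apply: lt_le_trans ws _].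
by apply: h2; apply: lt_le_trans zs _.
Qed.

End Holomorphic.

Section AnalyticHol.
Variables (R : realType) (V : normedModType R[i]).
Local Notation C := R[i].

Lemma cvg_bounded_rnorm (u : nat -> V) : cvgn u ->
  exists M : R, forall n, rnorm (u n) <= M.
Proof.
move=> /cvg_seq_bounded [M [_ Mu]].
have := Mu (M + 1); rewrite ltrDl ltr01 => /(_ isT) {}Mu.
exists (Re (M + 1)) => n; have /= := Mu n I; rewrite rnormE.
by rewrite lecE /= => /andP[].
Qed.

Lemma sum_half_le (N : nat) : \sum_(0 <= n < N) 2^-1 ^+ n <= 2 :> R.
Proof.
suff -> : \sum_(0 <= n < N) 2^-1 ^+ n = 2 - 2 * 2^-1 ^+ N :> R.
  by rewrite gerBl mulr_ge0// exprn_ge0// invr_ge0.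
elim: N => [|N ih]; first by rewrite big_geq// expr0; ring.
by rewrite big_nat_recr//= ih exprS; field.
Qed.

Lemma addsub4 (x y p q : V) : (x + p) - (y + q) - (x - y) = p - q.
Proof. by rewrite (opprD y q) addrACA [LHS]addrC addKr. Qed.

Lemma rnorm_sum (I : Type) (r : seq I) (F : I -> V) :
  rnorm (\sum_(i <- r) F i) <= \sum_(i <- r) rnorm (F i).
Proof.
elim/big_ind2: _ => //; first by rewrite rnorm0.
by move=> x a y b xa yb; rewrite (le_trans (rnormD _ _))// lerD.
Qed.

Lemma rnorm_subXX (u v : C) (eta : R) n : rnorm u <= eta -> rnorm v <= eta ->
  rnorm (u ^+ n.+1 - v ^+ n.+1) <= rnorm (u - v) * (n.+1%:R * eta ^+ n).
Proof.
move=> ue ve; elim: n => [|n ih].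
  by rewrite !expr1 expr0 !mulr1.
have e0 : 0 <= eta := le_trans (rnorm_ge0 _) ue.
rewrite (_ : _ - _ = u * (u ^+ n.+1 - v ^+ n.+1) + (u - v) * v ^+ n.+1); last first.
  by rewrite [u ^+ n.+2]exprS [v ^+ n.+2]exprS; ring.
rewrite (le_trans (rnormD _ _))// !rnormM rnormX.
have h1 : rnorm u * rnorm (u ^+ n.+1 - v ^+ n.+1) <=
    eta * (rnorm (u - v) * (n.+1%:R * eta ^+ n)).
  by rewrite ler_pM// rnorm_ge0.
have h2 : rnorm (u - v) * rnorm v ^+ n.+1 <= rnorm (u - v) * eta ^+ n.+1.
  by rewrite ler_wpM2l ?rnorm_ge0// lerXn2r ?nnegrE ?rnorm_ge0.
rewrite (le_trans (lerD h1 h2))// le_eqVlt; apply/orP; left; apply/eqP.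
by rewrite -[n.+2]addn1 natrD exprS; ring.
Qed.

(** A function with a norm convergent power series at z0 is strictly
    differentiable there, with a quadratic error term: Cauchy's bound on the
    coefficients reduces the remainder to a geometric series. *)
Lemma series_strict_diff (a : nat -> V) (f : C -> V) (z0 : C) (e : R) : 0 < e ->
  (forall z, `|z - z0| < e%:C ->
      series (fun n => (z - z0) ^+ n *: a n) @ \oo --> f z) ->
  exists K d : R, [/\ 0 <= K, 0 < d & forall eta z w, eta <= d ->
    rnorm (z - z0) <= eta -> rnorm (w - z0) <= eta ->
    rnorm (f z - f w - (z - w) *: a 1%N) <= K * eta * rnorm (z - w)].
Proof.
move=> e0 fs.
set b := e / 2; have b0 : 0 < b by rewrite divr_gt0.
have [M Mb] : exists M : R, forall n, rnorm (a n) * b ^+ n <= M.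
  have zb : `|(z0 + b%:C) - z0| < e%:C.
    rewrite addrAC subrr add0r rnormE ltcR rnormR (ger0_norm (ltW b0)) /b.
    by move: e0; lra.
  (* The terms of the convergent series at z0 + b are bounded. *)
  have : cvgn (series (fun n => (z0 + b%:C - z0) ^+ n *: a n)).
    by apply/cvg_ex; exists (f (z0 + b%:C)); exact: fs.
  move=> /cvg_series_cvg_0 c0.
  have /cvg_bounded_rnorm[M Mb] : cvgn (fun n => (z0 + b%:C - z0) ^+ n *: a n).
    by apply/cvg_ex; exists 0.
  exists M => n; rewrite (le_trans _ (Mb n))// addrAC subrr add0r rnormZ rnormX.
  by rewrite rnormR (ger0_norm (ltW b0)) mulrC.
have M0 : 0 <= M by rewrite (le_trans _ (Mb 0%N))// expr0 mulr1 rnorm_ge0.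
exists (4 * M / b ^+ 2), (b / 4); split.
- by apply: divr_ge0; [exact: mulr_ge0|apply: exprn_ge0; exact: ltW].
- by rewrite divr_gt0.
move=> eta z w etab ze we.
have eta0 : 0 <= eta := le_trans (rnorm_ge0 _) ze.
have ineb (x : C) : rnorm (x - z0) <= eta -> `|x - z0| < e%:C.
  move=> xe; rewrite rnormE ltcR (le_lt_trans xe)// (le_lt_trans etab)//.
  by rewrite /b; move: e0; lra.
set u := z - z0; set v := w - z0.
have uvE : z - w = u - v by rewrite /u /v; ring.
pose S x N := series (fun n => (x - z0) ^+ n *: a n) N.
have bound N : rnorm (S z N.+2 - S w N.+2 - (z - w) *: a 1%N) <=
    4 * M / b ^+ 2 * eta * rnorm (z - w).
  rewrite /S /series/= !big_nat_recl// !expr0 !expr1 -/u -/v.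
  rewrite (_ : _ - _ - _ =
      \sum_(0 <= i < N) (u ^+ i.+2 - v ^+ i.+2) *: a i.+2); last first.
    under [RHS]eq_bigr do rewrite (scalerBl (u ^+ _) (v ^+ _)).
    rewrite sumrB uvE (scalerBl u v).
    set A := \sum_(_ <= _ < _) _; set B := \sum_(_ <= _ < _) _.
    rewrite !scale1r (opprD (a 0%N)) addrACA subrr add0r; exact: addsub4.
  rewrite (le_trans (rnorm_sum _ _))//.
  apply: (@le_trans _ _ (\sum_(0 <= i < N)
      (2 * M / b ^+ 2 * eta * rnorm (u - v)) * 2^-1 ^+ i)).
    apply: ler_sum => i _; rewrite rnormZ.
    have hu := rnorm_subXX i.+1 ze we; rewrite -/u -/v in hu.
    have ha : rnorm (a i.+2) <= M / b ^+ i.+2.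
      by rewrite ler_pdivlMr ?exprn_gt0.
    apply: (le_trans (ler_pM (rnorm_ge0 _) (rnorm_ge0 _) hu ha)).
    have hi : i.+2%:R <= 2 * 2 ^+ i :> R.
      rewrite -natrX -natrM ler_nat mul2n -addnn -[i.+2]add1n leq_add ?expn_gt0//.
      exact: ltn_expl.
    have hb : (eta / b) ^+ i <= 4^-1 ^+ i.
      have q1 : eta / b <= 4^-1 by rewrite ler_pdivrMr// mulrC.
      have q0 : 0 <= eta / b by rewrite divr_ge0// ltW.
      by apply: lerXn2r => //; rewrite nnegrE// (le_trans q0).
    rewrite [leLHS](_ : _ = rnorm (u - v) * (M / b ^+ 2 * eta) *
        (i.+2%:R * (eta / b) ^+ i)); last first.
      rewrite (expr_div_n eta b i) (exprS eta i) (exprS b i.+1) (exprS b i).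
      have : b ^+ i != 0 by rewrite expf_neq0// gt_eqF.
      move: (b ^+ i) (eta ^+ i) (i.+2%:R : R) => B A n B0.
      by field; rewrite B0 gt_eqF.
    rewrite [leRHS](_ : _ = rnorm (u - v) * (M / b ^+ 2 * eta) *
        (2 * 2 ^+ i * 4^-1 ^+ i)); last first.
      rewrite (_ : 2 * 2 ^+ i * 4^-1 ^+ i = 2 * 2^-1 ^+ i); first by ring.
      rewrite -mulrA -exprMn; congr (_ * _ ^+ _); by field.
    have b20 : 0 <= M / b ^+ 2.
      by apply: divr_ge0 => //; apply: exprn_ge0; exact: ltW.
    apply: ler_wpM2l; first by apply: mulr_ge0; [exact: rnorm_ge0|exact: mulr_ge0].
    by apply: ler_pM => //; apply: exprn_ge0; rewrite divr_ge0// ltW.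
  rewrite -mulr_sumr -uvE.
  rewrite (_ : 4 * M / b ^+ 2 * eta * rnorm (z - w) =
      2 * M / b ^+ 2 * eta * rnorm (z - w) * 2); last by ring.
  apply: ler_wpM2l; last exact: sum_half_le.
  rewrite !mulr_ge0 ?rnorm_ge0// invr_ge0; apply: exprn_ge0; exact: ltW.
have sh x : rnorm (x - z0) <= eta -> S x N.+2 @[N --> \oo] --> f x.
  move=> /ineb/fs; rewrite -(cvg_shiftn 2); apply: cvg_trans.
  by apply: near_eq_cvg; apply: nearW => N; rewrite -[N.+2]addn2.
have Sf : rnorm (S z N.+2 - S w N.+2 - (z - w) *: a 1%N) @[N --> \oo] -->
    rnorm (f z - f w - (z - w) *: a 1%N).
  apply: cvg_rnorm; apply: cvgB; last exact: cvg_cst.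
  by apply: cvgB; exact: sh.
rewrite -(cvg_lim _ Sf)//; apply: limr_le; first by apply/cvg_ex; eexists; exact: Sf.
by near=> N; exact: bound.
Unshelve. all: by end_near. Qed.

Lemma scaleV_sub (z w : C) (x : V) : z != w -> (z - w) *: ((z - w)^-1 *: x) = x.
Proof. by move=> zw; rewrite scalerA mulfV ?scale1r// subr_eq0. Qed.

End AnalyticHol.

(** The derivatives at the centres of the local power series fit together: at
    a diagonal point (u, u) near (z, z), Q u u is compared with Q u v for a
    third point v much closer to u, to which the estimate at z applies. *)
Lemma analytic_hol (R : realType) (E : hilbertType R) (f : R[i] -> E) :
  analytic_on (@disc R) f -> exists Q, hol 1 f Q.
Proof.
move=> fa.
have {fa} : forall z0, exists c : E, disc z0 -> exists K d : R,
   [/\ 0 <= K, 0 < d & forall eta z w, eta <= d ->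
    rnorm (z - z0) <= eta -> rnorm (w - z0) <= eta ->
    rnorm (f z - f w - (z - w) *: c) <= K * eta * rnorm (z - w)].
  move=> z0; have [dz|] := pselect (disc z0); last by exists 0.
  have [a [e e0 fs]] := fa z0 dz.
  by exists (a 1%N) => _; exact: series_strict_diff e0 fs.
move=> /choice[c Hc].
pose Q z w := if z == w then c z else (z - w)^-1 *: (f z - f w).
have Qoff z w : z != w -> (z - w) *: Q z w = f z - f w.
  by move=> zw; rewrite /Q (negbTE zw) scaleV_sub.
have Qd z : Q z z = c z by rewrite /Q eqxx.
exists Q; split=> [z w _ _|z dz'].
  by have [->|zw] := eqVneq z w; [rewrite !subrr scale0r|rewrite Qoff].
have dz : disc z by apply/discE.
have [K [d [K0 d0 H]]] := Hc z dz.
have off u v eta : u != v -> eta <= d -> rnorm (u - z) <= eta ->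
    rnorm (v - z) <= eta -> rnorm (Q u v - c z) <= K * eta.
  move=> uv ed uz vz.
  have uv0 : 0 < rnorm (u - v) by apply: rnorm_gt0; apply/eqP; rewrite subr_eq0.
  rewrite -(ler_pM2l uv0) -rnormZ scalerBr Qoff// mulrC.
  exact: H.
have diag u eta : disc u -> eta <= d -> rnorm (u - z) < eta ->
    rnorm (c u - c z) <= K * eta.
  move=> du ed uz; have [K' [d' [K'0 d'0 H']]] := Hc u du.
  apply/ler_addgt0Pr => e e0.
  pose t := Num.min (Num.min d' (eta - rnorm (u - z))) (e / (K' + 1)).
  have t0 : 0 < t.
    by rewrite !lt_min d'0 subr_gt0 uz divr_gt0// ltr_wpDl.
  have tt1 : t <= d' by rewrite !ge_min lexx.
  have tt2 : t <= eta - rnorm (u - z) by rewrite !ge_min lexx orbT.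
  have tt3 : t <= e / (K' + 1) by rewrite !ge_min lexx !orbT.
  have tE : rnorm (t%:C : R[i]) = t by rewrite rnormR ger0_norm// ltW.
  pose v := u + t%:C.
  have vu : rnorm (v - u) = t by rewrite /v addrAC subrr add0r.
  have uv : u != v.
    by apply/eqP => uv; move: vu; rewrite -uv subrr rnorm0 => tt; rewrite -tt ltxx in t0.
  have h1 : rnorm (Q u v - c z) <= K * eta.
    apply: off => //; first exact: ltW.
    by rewrite (le_trans (rnorm_trans _ _ u))// vu -lerBrDr.
  have h2 : rnorm (c u - Q u v) <= e.
    have uv0 : 0 < rnorm (u - v) by rewrite rnormC vu.
    rewrite -(ler_pM2l uv0) -rnormZ scalerBr Qoff// rnormC mulrC.
    rewrite (le_trans (H' t u v tt1 _ _))//; [by rewrite subrr rnorm0 ltW|by rewrite vu|].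
    rewrite ler_wpM2r ?rnorm_ge0//.
    rewrite (le_trans (ler_wpM2l K'0 tt3))// mulrA ler_pdivrMr ?ltr_wpDl//.
    by rewrite [leLHS]mulrC (ler_pM2l e0) lerDl.
  by rewrite (le_trans (rnorm_trans _ _ (Q u v)))// addrC lerD.
rewrite Qd; apply/cvg_rnormP => e e0.
pose eta := Num.min d (e / (K + 1)).
have eta0 : 0 < eta by rewrite lt_min d0 divr_gt0// ltr_wpDl.
have ed : eta <= d by rewrite ge_min lexx.
have Ke : K * eta < e.
  have h : eta <= e / (K + 1) by rewrite ge_min lexx orbT.
  rewrite (le_lt_trans (ler_wpM2l K0 h))// mulrA ltr_pdivrMr ?ltr_wpDl//.
  by rewrite [ltLHS]mulrC (ltr_pM2l e0) ltrDl.
have n1 := (cvg_rnormP _ _ _).1 (@cvg_fst_diag R z) eta eta0.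
have n2 := (cvg_rnormP _ _ _).1 (@cvg_snd_diag R z) eta eta0.
have n3 := near_rnorm_lt _ dz' (@cvg_fst_diag R z).
near=> p; rewrite (le_lt_trans _ Ke)//.
have p1 : rnorm (p.1 - z) < eta by near: p; exact: n1.
have p2 : rnorm (p.2 - z) < eta by near: p; exact: n2.
have [pp|pp] := eqVneq p.1 p.2.
  rewrite -pp Qd; apply: diag => //.
  by apply/discE; near: p; exact: n3.
by apply: off => //; exact: ltW.
Unshelve. all: by end_near. Qed.

(** * Integrals over the circle *)

Section CircleIntegral.
Variable R : realType.
Local Notation mu := (@lebesgue_measure R).
Implicit Types f g : R -> R.

Definition circ f : R := \int[mu]_(t in `[0, 2 * pi]) f t.

Lemma twopi_gt0 : 0 < 2 * pi :> R.
Proof. by rewrite mulr_gt0// pi_gt0. Qed.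

Lemma mu_circ : mu `[0, 2 * pi]%classic = (2 * pi)%:E.
Proof. by rewrite lebesgue_measure_itv/= lte_fin twopi_gt0 -EFinD subr0. Qed.

Lemma continuous_integrable f (K : set R) : compact K -> continuous f ->
  mu.-integrable K (EFin \o f).
Proof.
move=> cK cf; apply: continuous_compact_integrable => //.
exact: continuous_subspaceT.
Qed.

Lemma circ_integrable f : continuous f -> mu.-integrable `[0, 2 * pi] (EFin \o f).
Proof. by apply: continuous_integrable; exact: segment_compact. Qed.

Lemma circD f g : continuous f -> continuous g ->
  circ (fun t => f t + g t) = circ f + circ g.
Proof. by move=> cf cg; rewrite /circ RintegralD//; exact: circ_integrable. Qed.

Lemma circB f g : continuous f -> continuous g ->
  circ (fun t => f t - g t) = circ f - circ g.
Proof. by move=> cf cg; rewrite /circ RintegralB//; exact: circ_integrable. Qed.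

Lemma circZ c f : continuous f -> circ (fun t => c * f t) = c * circ f.
Proof. by move=> cf; rewrite /circ RintegralZl//; exact: circ_integrable. Qed.

Lemma le_circ f g : continuous f -> continuous g ->
  (forall t, 0 <= t -> t <= 2 * pi -> f t <= g t) -> circ f <= circ g.
Proof.
move=> cf cg fg; rewrite /circ le_Rintegral//; [exact: circ_integrable..|].
by move=> t /=; rewrite in_itv/= => /andP[]; exact: fg.
Qed.

Lemma circ_cst c : circ (fun=> c) = c * (2 * pi).
Proof.
rewrite /circ Rintegral_cst; last exact: measurable_itv.
by congr (_ * _); exact: (congr1 fine mu_circ).
Qed.

Lemma circ_bound f B : continuous f ->
  (forall t, 0 <= t -> t <= 2 * pi -> `|f t| <= B) -> `|circ f| <= B * (2 * pi).
Proof.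
move=> cf fB; rewrite ler_norml -mulNr -!circ_cst; apply/andP; split;
  apply: le_circ => //; try exact: cst_continuous;
  by move=> t t0 t1; have := fB t t0 t1; rewrite ler_norml => /andP[].
Qed.

Lemma eq_circ f g : f =1 g -> circ f = circ g.
Proof. by move=> /funext ->. Qed.

(** Periodicity cancels the boundary terms. The derivative is given by a
    difference quotient q, in the form in which hol provides it. *)
Lemma circ_deriv (L : R -> R) (q : R -> R -> R) :
  (forall t' t, L t' - L t = (t' - t) * q t' t) ->
  (forall t, q t' t @[t' --> t] --> q t t) ->
  continuous (fun t => q t t) -> L (2 * pi) = L 0 -> circ (fun t => q t t) = 0.
Proof.
move=> Lq qt cq Lp.
have dL (t : R) : is_derive t (1 : R) L (q t t).
  by apply/is_derive1_caratheodory; exists (q ^~ t); split; [move=> z; rewrite mulrC|exact: qt|].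
have cL : continuous L.
  by move=> t; apply: differentiable_continuous; apply/derivable1_diffP; case: (dL t).
rewrite /circ /Rintegral (@continuous_FTC2 _ _ L).
- by rewrite Lp subee.
- exact: twopi_gt0.
- exact: continuous_subspaceT.
- split.
  + by move=> t _; case: (dL t).
  + exact: cvg_at_right_filter (cL _).
  + exact: cvg_at_left_filter (cL _).
- by move=> t _; rewrite derive1E; case: (dL t).
Qed.

(** Joint continuity is uniform along a compact set, by covering it. *)
Lemma unif_near (T : topologicalType) (G : T -> R -> R) (p0 : T) (K : set R) :
  compact K -> (forall t, K t -> G q.1 q.2 @[q --> (p0, t)] --> G p0 t) ->
  forall e : R, 0 < e -> \forall p \near p0, forall t, K t -> `|G p t - G p0 t| < e.
Proof.
move=> /compact_near_coveringP cK cG e e0.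
apply: (cK T (nbhs p0) (fun p t => `|G p t - G p0 t| < e) (nbhs_filter p0)).
move=> t Kt; have e20 : 0 < e / 2 by rewrite divr_gt0.
have /cvgrPdistC_lt/(_ _ e20) := cG t Kt.
case=> -[/= U V] [Up0 Vt] UV; exists (V, U) => // -[s p] /= [Vs Up].
have h1 := UV (p, s) (conj Up Vs).
have h2 := UV (p0, s) (conj (nbhs_singleton Up0) Vs).
rewrite /= in h1 h2.
rewrite (_ : _ - _ = (G p s - G p0 t) - (G p0 s - G p0 t)); last by ring.
by rewrite (le_lt_trans (ler_normB _ _))// [e]splitr ltrD.
Qed.

(** Differentiation under the integral sign. In the applications the partial
    derivative D l l in the parameter is also an angular derivative, so its
    integral vanishes by circ_deriv; this replaces contour integration. *)
Lemma circ_const (K : R -> R -> R) (D : R -> R -> R -> R) (a b : R) :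
  (forall l, l \in `]a, b[ -> continuous (K l)) ->
  (forall l' l t, l' \in `]a, b[ -> l \in `]a, b[ ->
     K l' t - K l t = (l' - l) * D l' l t) ->
  (forall l t, l \in `]a, b[ -> D q.1 l q.2 @[q --> (l, t)] --> D l l t) ->
  (forall l, l \in `]a, b[ -> circ (D l l) = 0) ->
  forall l l', l \in `]a, b[ -> l' \in `]a, b[ -> circ (K l) = circ (K l').
Proof.
move=> cK KD cD D0.
have dcirc l : l \in `]a, b[ -> is_derive (l : R) (1 : R) (fun x => circ (K x)) 0.
  move=> lab; apply/is_derive1_caratheodory.
  have cDl : continuous (D l l).
    move=> t; have c1 : (fun=> l) @ t --> l by exact: cvg_cst.
    exact: (cvg_comp _ _ (cvg_pair c1 (@cvg_id _ (nbhs t))) (cD l t lab)).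
  pose g x := if x == l then 0 else (circ (K x) - circ (K l)) / (x - l).
  exists g; split; last by rewrite /g eqxx.
    move=> z; rewrite /g; case: eqP => [->|/eqP zl]; first by rewrite !subrr mulr0.
    by rewrite divfK// subr_eq0.
  have gl : g l = 0 by rewrite /g eqxx.
  rewrite /prop_for /continuous_at gl; apply/cvgrPdistC_le => e e0.
  pose d := e / (2 * pi); have d0 : 0 < d by rewrite divr_gt0// twopi_gt0.
  have := @unif_near _ (fun x => D x l) l `[0, 2 * pi]%classic
    (@segment_compact _ _ _) (fun t _ => cD l t lab) _ d0.
  move=> U; near=> z; rewrite subr0 /g; case: eqP => [_|/eqP zl].
    by rewrite normr0 ltW.
  have zab : z \in `]a, b[ by near: z; exact: near_in_itvoo.
  have zl0 : 0 < `|z - l| by rewrite normr_gt0 subr_eq0.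
  rewrite normrM normfV ler_pdivrMr//.
  have cKl : continuous (fun t => (z - l) * D l l t).
    by move=> t; apply: cvgM; [exact: cvg_cst|exact: cDl].
  rewrite -[X in `|X|]subr0 -(mulr0 (z - l)) -(D0 l lab) -circZ//.
  have cKK : continuous (fun t => K z t - K l t).
    by move=> t; apply: cvgB; exact: cK.
  rewrite -circB//; [|exact: cK..]. rewrite -circB//.
  rewrite (_ : e * _ = d * `|z - l| * (2 * pi)); last first.
    rewrite /d; have := @pi_gt0 R; move: (pi : R) => p p0; field.
    by rewrite gt_eqF.
  apply: circ_bound; first by move=> t; apply: cvgB; [exact: cKK|exact: cKl].
  move=> t t0 t1; rewrite KD// -mulrBr normrM mulrC ler_wpM2r//.
  apply: ltW; have : (forall t, `[0, 2 * pi]%classic t -> `|D z l t - D l l t| < d).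
    by near: z; exact: U.
  by apply; rewrite /= in_itv/= t0.
move=> l l'; wlog : l l' / l <= l'.
  by move=> H lab lab'; have [ll|/ltW ll] := leP l l'; [|apply/esym]; exact: H.
move=> ll lab lab'.
have sub x : x \in `[l, l'] -> x \in `]a, b[.
  move: lab lab'; rewrite !in_itv/= => /andP[al _] /andP[_ lb] /andP[lx xl].
  by rewrite (lt_le_trans al)// (le_lt_trans xl).
pose I x := circ (K x); rewrite -[LHS]/(I l) -[RHS]/(I l').
have dI x : x \in `[l, l'] -> is_derive (x : R) (1 : R) I 0.
  by move=> /sub; exact: dcirc.
have dI' x : x \in `]l, l'[ -> is_derive (x : R) (1 : R) I ((fun=> 0) x).
  by move=> xl; apply: dI; exact: subset_itv_oo_cc.
have cI : {within `[l, l'], continuous I}.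
  by apply: derivable_within_continuous => x xl; case: (dI x xl).
have [c _] := MVT_segment ll dI' cI.
by rewrite mul0r => /eqP; rewrite subr_eq0 => /eqP.
Unshelve. all: by end_near. Qed.

End CircleIntegral.

(** * The Poisson kernel *)

Section Poisson.
Variable R : realType.
Local Notation C := R[i].

Lemma Re_conjc (z : C) : Re (conjc z) = Re z.
Proof. by case: z. Qed.

Lemma real_complex_eq0 (r : R) : (r%:C == 0 :> C) = (r == 0).
Proof. by rewrite eq_complex/= eqxx andbT. Qed.

Lemma scalecE (z w : C) : z *: w = z * w.
Proof. by []. Qed.

Lemma Im_iM (z : C) : Im ('i%C * z) = Re z.
Proof. by rewrite Im_mul/= mul0r add0r mul1r. Qed.

Lemma Im_conj_iM (z : C) : Im (conjc 'i%C * z) = - Re z.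
Proof. by rewrite Im_mul/= mul0r add0r mulN1r. Qed.

Lemma derive_quotient (f df : R -> R) :
  (forall t : R, is_derive t (1 : R) f (df t)) -> exists q : R -> R -> R,
  [/\ forall t' t, f t' - f t = (t' - t) * q t' t,
      forall t, q t' t @[t' --> t] --> q t t & forall t, q t t = df t].
Proof.
move=> fd.
have /choice[g gP] : forall t : R, exists g : R -> R,
    [/\ forall z, f z - f t = g z * (z - t), {for t, continuous g} & g t = df t].
  by move=> t; apply/is_derive1_caratheodory.
exists (fun t' t => g t t'); split=> [t' t|t|t].
- by have [-> _ _] := gP t; rewrite mulrC.
- by have [_ gt _] := gP t.
- by have [_ _ ->] := gP t.
Qed.

Lemma cis_quotient : exists q : R -> R -> C,
  [/\ forall t' t, cis t' - cis t = (t' - t)%:C * q t' t,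
      forall t, q t' t @[t' --> t] --> q t t & forall t, q t t = 'i%C * cis t].
Proof.
have [c [c1 c2 c3]] := @derive_quotient cos (fun t => - sin t) (@is_derive_cos R).
have [s [s1 s2 s3]] := @derive_quotient sin cos (@is_derive_sin R).
exists (fun t' t => c t' t +i* s t' t); split=> [t' t|t|t].
- apply: complex_ext; rewrite /cis ?Re_sub ?Im_sub ?Re_scale ?Im_scale/=; [exact: c1|exact: s1].
- by apply: cvg_ReIm; [exact: c2|exact: s2].
- rewrite c3 s3; apply: complex_ext; rewrite ?Re_mul ?Im_mul/=; ring.
Qed.

Lemma cvg_circle (T : Type) (F : set_system T) (FF : Filter F)
    (l t : T -> R) (l0 t0 : R) :
  l @ F --> l0 -> t @ F --> t0 ->
  ((l x)%:C * cis (t x) : C) @[x --> F] --> (l0%:C * cis t0 : C).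
Proof.
move=> ll tt; apply: cvgM.
  exact: (cvg_comp _ _ ll (@continuous_real_complex R l0)).
exact: (cvg_comp _ _ tt (@continuous_cis R t0)).
Qed.

(** Cauchy's formula on the circle of radius rho, for the kernel
    c = zeta / (zeta - a): contracting the circle to the point a does not
    change the mean, because the derivative in the contraction parameter l is
    l ^-1 times an angular derivative. *)
Lemma circ_cauchy (r rho : R) (F : C -> C) (Q : C -> C -> C) (a : C) (c : R -> C) :
  hol r F Q -> 0 < rho -> rho < r -> rnorm a < rho -> continuous c ->
  (forall t, (rho%:C * cis t - a) * c t = rho%:C * cis t) ->
  circ (fun t => Re (F (rho%:C * cis t) * c t)) = circ (fun t => Re (F a * c t)).
Proof.
move=> hF rho0 rhor arho cc cE.
have [q [q1 q2 q3]] := cis_quotient.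
pose p (l t : R) : C := a + l%:C * (rho%:C * cis t - a).
pose d := (r - rho) / (4 * rho).
have d0 : 0 < d by rewrite divr_gt0 ?subr_gt0// mulr_gt0.
have dr : (1 + 2 * d) * rho < r.
  rewrite (_ : _ * rho = (r + rho) / 2); first by move: rhor; lra.
  by rewrite /d; field; rewrite gt_eqF.
have pr l t : l \in `](- d), (1 + d)[ -> rnorm (p l t) < r.
  rewrite in_itv/= => /andP[dl ld]; apply: le_lt_trans dr.
  rewrite (_ : p l t = (1 - l)%:C * a + l%:C * (rho%:C * cis t)); last first.
    by rewrite /p real_complexB; ring.
  rewrite (le_trans (rnormD _ _))// !rnormM !rnormR rnorm_cis mulr1 (gtr0_norm rho0).
  apply: (@le_trans _ _ ((`|1 - l| + `|l|) * rho)).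
    by rewrite mulrDl lerD2r ler_wpM2l// ltW.
  apply: ler_wpM2r; first exact: ltW.
  by case: (ger0P (1 - l)); case: (ger0P l); lra.
have cp (T : Type) (G : set_system T) (FG : Filter G) (l t : T -> R) (l0 t0 : R) :
    l @ G --> l0 -> t @ G --> t0 -> p (l x) (t x) @[x --> G] --> p l0 t0.
  move=> ll tt; apply: cvgD; first exact: cvg_cst.
  apply: cvgM; first exact: (cvg_comp _ _ ll (@continuous_real_complex R l0)).
  apply: cvgB; last exact: cvg_cst.
  by apply: cvg_circle => //; exact: cvg_cst.
pose K l t := Re (F (p l t) * c t).
pose D l' l t := Re (rho%:C * cis t * Q (p l' t) (p l t)).
have c1 : 1 \in `](- d), (1 + d)[ by rewrite in_itv/=; apply/andP; split; lra.
have c0 : 0 \in `](- d), (1 + d)[ by rewrite in_itv/=; apply/andP; split; lra.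
transitivity (circ (K 1)).
  by apply: eq_circ => t; rewrite /K /p; congr (Re (F _ * _)); ring.
transitivity (circ (K 0)); last first.
  by apply: eq_circ => t; rewrite /K /p; congr (Re (F _ * _)); ring.
apply: (@circ_const _ K D (- d) (1 + d)) => //.
- move=> l lI t; apply: cvg_Re; apply: cvgM; last exact: cc.
  by apply: (hol_cvg hF); [exact: pr|apply: cp; [exact: cvg_cst|exact: cvg_id]].
- move=> l' l t lI' lI; rewrite /K /D -Re_sub -Re_scale -mulrBl.
  rewrite (hF.1 _ _ (pr _ _ lI') (pr _ _ lI)) -(cE t); congr Re.
  by rewrite /p /GRing.scale/= real_complexB; ring.
- move=> l t lI; rewrite /D; apply: cvg_Re; apply: cvgM.
    by apply: cvg_circle; [exact: cvg_cst|exact: cvg_snd].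
  apply: (hol_cvgQ hF); first exact: pr.
    by apply: cp; [exact: cvg_fst|exact: cvg_snd].
  by apply: cp; [exact: cvg_cst|exact: cvg_snd].
- move=> l lI.
  pose qq t' t := rho * Im (q t' t * Q (p l t') (p l t)).
  have qqE t : qq t t = D l l t.
    rewrite /qq q3 /D -[X in Re X]mulrA Re_scale -[X in Im X]mulrA; congr (_ * _).
    exact: Im_iM.
  rewrite -(eq_circ qqE).
  have cqq t : qq t' t @[t' --> t] --> qq t t.
    apply: cvgM; first exact: cvg_cst.
    apply: cvg_Im; apply: cvgM; first exact: q2.
    apply: (hol_cvgQ hF); first exact: pr.
      by apply: cp; [exact: cvg_cst|exact: cvg_id].
    exact: cvg_cst.
  have cqqd : continuous (fun t => qq t t).
    rewrite (_ : (fun t => qq t t) = D l l); last exact/funext.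
    move=> t.
    apply: cvg_Re; apply: cvgM.
      by apply: cvg_circle; [exact: cvg_cst|exact: cvg_id].
    by apply: (hol_cvgQ hF); [exact: pr|apply: cp; [exact: cvg_cst|exact: cvg_id]..].
  (* At l = 0 the contracted circle is a point, and the primitive in t is the
     one of a linear function. *)
  have [l0|l0] := eqVneq l 0.
    apply: (@circ_deriv _ (fun t => rho * Im (cis t * Q a a))) => //.
      move=> t' t; rewrite /qq -mulrBr -Im_sub -mulrBl q1 -mulrA Im_scale.
      by rewrite /p l0 !mul0r !addr0; ring.
    by rewrite cis_2pi.
  apply: (@circ_deriv _ (fun t => l^-1 * Im (F (p l t)))) => //.
    move=> t' t; rewrite -mulrBr -Im_sub (hF.1 _ _ (pr _ _ lI) (pr _ _ lI)).
    rewrite (_ : p l t' - p l t = (l * rho * (t' - t))%:C * q t' t); last first.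
      by rewrite !real_complexM -mulrA -q1 /p; ring.
    by rewrite scalecE -mulrA Im_scale /qq; field.
  by rewrite /p cis_2pi.
Qed.

Lemma circle_eq_rnorm (rho t : R) (a : C) :
  rho%:C * cis t - a = 0 -> rnorm a = `|rho|.
Proof.
by move=> /eqP; rewrite subr_eq0 => /eqP <-; rewrite rnormM rnorm_cis mulr1 rnormR.
Qed.

Lemma circle_neq (rho t : R) (a : C) : rnorm a < rho -> rho%:C * cis t - a != 0.
Proof.
move=> ar; apply/eqP => /circle_eq_rnorm aE; move: ar.
by rewrite aE ltNge ler_norm.
Qed.

Lemma rnorm_circle_gt0 (rho t : R) (a : C) :
  rnorm a < rho -> 0 < rnorm (rho%:C * cis t - a).
Proof. by move=> ar; apply: rnorm_gt0; apply/eqP; exact: circle_neq. Qed.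

Definition poisson (rho : R) (a : C) (t : R) : R :=
  (rho ^+ 2 - rnorm a ^+ 2) / rnorm (rho%:C * cis t - a) ^+ 2.

Definition cauchy_kernel (rho : R) (a : C) (t : R) : C :=
  rho%:C * cis t / (rho%:C * cis t - a).

Section Kernel.
Variables (rho : R) (a : C).
Hypothesis arho : rnorm a < rho.

Lemma cauchy_kernelE t :
  (rho%:C * cis t - a) * cauchy_kernel rho a t = rho%:C * cis t.
Proof. by rewrite mulrC divfK// circle_neq. Qed.

Lemma continuous_circle : continuous (fun t => rho%:C * cis t : C).
Proof. by move=> t; apply: cvg_circle; [exact: cvg_cst|exact: cvg_id]. Qed.

Lemma continuous_circleB : continuous (fun t => rho%:C * cis t - a : C).
Proof. by move=> t; apply: cvgB; [exact: continuous_circle|exact: cvg_cst]. Qed.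

Lemma continuous_cauchy_kernel : continuous (cauchy_kernel rho a).
Proof.
move=> t; apply: cvgM; first exact: continuous_circle.
by apply: cvgV; [exact: circle_neq|exact: continuous_circleB].
Qed.

Lemma continuous_poisson : continuous (poisson rho a).
Proof.
move=> t; apply: cvgM; first exact: cvg_cst.
apply: cvgV; first by rewrite expf_neq0// gt_eqF// rnorm_circle_gt0.
by apply: cvgM; apply: cvg_rnorm; exact: continuous_circleB.
Qed.

Lemma poisson_ge0 t : 0 <= poisson rho a t.
Proof.
apply: divr_ge0; last exact: sqr_ge0.
by rewrite subr_ge0; have := rnorm_ge0 a; move: arho; nra.
Qed.

Lemma poisson_cauchy t : poisson rho a t = 2 * Re (cauchy_kernel rho a t) - 1.
Proof.
rewrite /poisson /cauchy_kernel.
have := rnorm_circle_gt0 t arho.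
have : rnorm (rho%:C * cis t) ^+ 2 = rho ^+ 2.
  by rewrite rnormM rnorm_cis mulr1 rnormR real_normK ?num_real.
move: (rho%:C * cis t) => z zr n0; rewrite -zr.
have -> : z / (z - a) = (rnorm (z - a) ^- 2)%:C * (z * conjc (z - a)).
  have za : z - a != 0 by apply/eqP => za; move: n0; rewrite za rnorm0 ltxx.
  have ca : conjc (z - a) != 0 by rewrite conjc_eq0.
  rewrite real_complexV -mul_conjc.
  by move: (conjc (z - a)) ca => w w0; field; rewrite w0 za.
rewrite Re_scale.
have -> : rnorm z ^+ 2 - rnorm a ^+ 2 =
    2 * Re (z * conjc (z - a)) - rnorm (z - a) ^+ 2.
  rewrite !rnorm_sqr Re_mul; case: z a {zr n0} => [x y] [u v] /=; ring.
by field; rewrite gt_eqF.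
Qed.

End Kernel.

(** On the circle the conjugate of the Cauchy kernel is 1 / (1 - b e), with
    b = conj a / rho and e = exp(it), and the mean of the holomorphic function
    1 / (1 - b z) is its value 1 at 0. *)
Lemma circ_cauchy_kernel (rho : R) (a : C) : 0 < rho -> rnorm a < rho ->
  circ (fun t => Re (cauchy_kernel rho a t)) = 2 * pi.
Proof.
move=> rho0 ar.
pose b := conjc a / rho%:C.
have b0 : 0 <= rnorm b := rnorm_ge0 b.
have b1 : rnorm b < 1.
  by rewrite rnormM rnormJ rnormV rnormR gtr0_norm// ltr_pdivrMr// mul1r.
pose r := 2 / (1 + rnorm b).
have r1 : 1 < r by rewrite ltr_pdivlMr; lra.
have bz z : rnorm z < r -> 1 - b * z != 0.
  rewrite ltr_pdivlMr; last by lra.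
  move=> zr; apply/eqP => /subr0_eq /(congr1 (@rnorm R C)).
  rewrite rnorm1 rnormM; have := rnorm_ge0 z; nra.
have [Q hF] : exists Q, hol r (fun z => (1 - b * z)^-1) Q.
  eexists; apply: hol_inv => //.
  rewrite (_ : (fun z => 1 - b * z) = (fun z => 1 + - b * z)).
    exact: (hol_add (hol_cst r (1 : C)) (hol_mul (hol_cst r (- b)) (hol_id r))).
  by apply/funext => z; rewrite mulNr.
have c1 : continuous (fun _ : R => 1 : C) by exact: cst_continuous.
have r0 : rnorm (0 : C) < 1 by rewrite rnorm0.
have := @circ_cauchy r 1 _ Q 0 (fun=> 1) hF ltr01 r1 r0 c1.
rewrite mulr0 subr0 invr1 mulr1 circ_cst mul1r => <-; last first.
  by move=> t; rewrite mulr1 subr0.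
apply: eq_circ => t; rewrite mulr1 -[RHS]Re_conjc; congr Re.
have r0' : rho%:C != 0 :> C by rewrite real_complex_eq0 gt_eqF.
have -> : conjc (1 - b * (1%:C * cis t))^-1 = (1 - a / rho%:C * (cis t)^-1)^-1.
  rewrite conjcV conjcB conjc1 !conjcM conjc_cis conjcK.
  by rewrite conjcV !conjc_real mul1r.
rewrite /cauchy_kernel; have := circle_neq t ar; have := cis_neq0 t.
move: (cis t) => e e0 ea; field.
by rewrite ea e0 r0'.
Qed.

Lemma circ_poisson (rho : R) (a : C) : 0 < rho -> rnorm a < rho ->
  circ (poisson rho a) = 2 * pi.
Proof.
move=> rho0 ar; rewrite (eq_circ (poisson_cauchy ar)).
have ck := continuous_cauchy_kernel ar.
have cRe : continuous (fun t => Re (cauchy_kernel rho a t)).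
  by move=> t; apply: cvg_Re; exact: ck.
rewrite circB; [|by move=> t; apply: cvgM; [exact: cvg_cst|exact: cRe]|exact: cst_continuous].
by rewrite circZ// circ_cauchy_kernel// circ_cst; ring.
Qed.

(** The Cauchy formula, applied to F z / (rho ^ 2 - conj a z), turns the
    Cauchy kernel into the positive Poisson kernel. *)
Lemma poisson_ineq (r rho : R) (F : C -> C) Q (a : C) :
  hol r F Q -> 0 < rho -> rho < r -> rnorm a < rho ->
  2 * pi * rnorm (F a) <=
  circ (fun t => rnorm (F (rho%:C * cis t)) * poisson rho a t).
Proof.
move=> hF rho0 rhor ar; have a0 := rnorm_ge0 a.
(* A radius beyond rho that stays below the pole rho ^ 2 / |a|. *)
pose s := Num.min r (2 * rho ^+ 2 / (rho + rnorm a)).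
have rho_s : rho < s.
  by rewrite lt_min rhor/= ltr_pdivlMr; [nra|lra].
have den z : rnorm z < s -> (rho ^+ 2)%:C - conjc a * z != 0.
  rewrite lt_min => /andP[_]; rewrite ltr_pdivlMr; last by lra.
  move=> zs; apply/eqP => /eqP; rewrite subr_eq0 => /eqP /(congr1 (@rnorm _ _)).
  rewrite rnormR rnormM rnormJ ger0_norm ?sqr_ge0//; have := rnorm_ge0 z.
  by move: zs a0 ar rho0; nra.
have [n0|n0] := eqVneq (rnorm (F a)) 0.
  rewrite n0 mulr0; apply: Rintegral_ge0 => t _.
  by rewrite mulr_ge0 ?rnorm_ge0// poisson_ge0.
have nC0 : (rnorm (F a))%:C != 0 :> C by rewrite real_complex_eq0.
pose u := conjc (F a) / (rnorm (F a))%:C.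
have u1 : rnorm u = 1.
  by rewrite rnormM rnormJ rnormV rnormR ger0_norm ?rnorm_ge0// mulfV.
have uF : u * F a = (rnorm (F a))%:C.
  rewrite /u mulrAC [X in X / _]mulrC mul_conjc real_complexX.
  by rewrite expr2 mulfK.
have [P hG] : exists P,
    hol s (fun z => u * F z * ((rho ^+ 2)%:C - conjc a * z)^-1) P.
  eexists; apply: hol_mul.
    apply: hol_mul; first exact: hol_cst.
    by apply: (hol_le _ hF); rewrite ge_min lexx.
  apply: hol_inv => //.
  rewrite (_ : (fun z => _ - _) = (fun z => (rho ^+ 2)%:C + - conjc a * z)).
    exact: (hol_add (hol_cst s (rho ^+ 2)%:C)
                    (hol_mul (hol_cst s (- conjc a)) (hol_id s))).
  by apply/funext => z; rewrite mulNr.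
set G := (fun z => _) in hG.
have : circ (fun t => Re (G (rho%:C * cis t) * cauchy_kernel rho a t)) =
    circ (fun t => Re (G a * cauchy_kernel rho a t)).
  exact: circ_cauchy hG rho0 rho_s ar (continuous_cauchy_kernel ar) (cauchy_kernelE ar).
have Ga : G a = (rnorm (F a) / (rho ^+ 2 - rnorm a ^+ 2))%:C.
  rewrite /G uF [conjc a * a]mulrC mul_conjc -real_complexB -real_complexV.
  by rewrite real_complexM.
have GP t : G (rho%:C * cis t) * cauchy_kernel rho a t =
    u * F (rho%:C * cis t) * (rnorm (rho%:C * cis t - a) ^- 2)%:C.
  rewrite /G -!mulrA; congr (_ * (_ * _)).
  rewrite real_complexV -mul_conjc conjcB conjcM conjc_cis conjc_real /cauchy_kernel.
  have := circle_neq t ar.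
  have : (rho%:C / cis t - conjc a != 0 :> C).
    rewrite -conjc_cis -[rho%:C](conjc_real rho) -conjcM -conjcB conjc_eq0.
    exact: circle_neq.
  have : (rho ^+ 2)%:C - conjc a * (rho%:C * cis t) != 0 :> C.
    by apply: den; rewrite rnormM rnormR rnorm_cis mulr1 gtr0_norm.
  have := cis_neq0 t; rewrite real_complexX.
  move: (cis t) (conjc a) (rho%:C : C) => e ac p e0 d1 d2 d3; field.
  rewrite e0 d1 d3 (_ : p + - ac * e = e * (p / e - ac)) ?mulf_neq0//.
  by field.
have aE0 : 0 < rho ^+ 2 - rnorm a ^+ 2 by nra.
rewrite Ga.
rewrite [RHS](_ : _ = rnorm (F a) / (rho ^+ 2 - rnorm a ^+ 2) * (2 * pi)); last first.
  rewrite -(circ_cauchy_kernel rho0 ar) -circZ.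
    by apply: eq_circ => t; rewrite Re_scale.
  by move=> t; apply: cvg_Re; exact: continuous_cauchy_kernel.
move=> H.
rewrite (_ : 2 * pi * _ = (rho ^+ 2 - rnorm a ^+ 2) *
  (rnorm (F a) / (rho ^+ 2 - rnorm a ^+ 2) * (2 * pi))); last first.
  by field; rewrite gt_eqF.
have cF : continuous (fun t => F (rho%:C * cis t)).
  move=> t; apply: (hol_cvg hF); last exact: continuous_circle.
  by rewrite rnormM rnormR rnorm_cis mulr1 gtr0_norm.
have cG : continuous (fun t => Re (G (rho%:C * cis t) * cauchy_kernel rho a t)).
  move=> t; apply: cvg_Re; apply: cvgM; last exact: continuous_cauchy_kernel.
  apply: (hol_cvg hG); last exact: continuous_circle.
  by rewrite rnormM rnormR rnorm_cis mulr1 gtr0_norm.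
rewrite -H -circZ//; apply: le_circ.
- by move=> t; apply: cvgM; [exact: cvg_cst|exact: cG].
- move=> t; apply: cvgM; last exact: continuous_poisson.
  by apply: cvg_rnorm; exact: cF.
- move=> t _ _; rewrite GP /poisson mulrCA ler_pM2l//.
  rewrite (le_trans (Re_le_rnorm _))// (rnormM (u * _)) (rnormM u) u1 mul1r rnormR ger0_norm//.
  by rewrite invr_ge0 sqr_ge0.
Qed.

(** Pairing with f a reduces to the scalar case, without integrating vectors. *)
Lemma poisson_ineq_hilbert (r rho : R) (E : hilbertType R) (f : C -> E) Q (a : C) :
  hol r f Q -> 0 < rho -> rho < r -> rnorm a < rho ->
  2 * pi * rnorm (f a) <=
  circ (fun t => rnorm (f (rho%:C * cis t)) * poisson rho a t).
Proof.
move=> hf rho0 rhor ar.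
have [n0|n0] := eqVneq (rnorm (f a)) 0.
  rewrite n0 mulr0; apply: Rintegral_ge0 => t _.
  by rewrite mulr_ge0 ?rnorm_ge0// poisson_ge0.
have {}n0 : 0 < rnorm (f a) by rewrite lt_neqAle eq_sym n0 rnorm_ge0.
have cf : continuous (fun t => f (rho%:C * cis t)).
  move=> t; apply: (hol_cvg hf); last exact: continuous_circle.
  by rewrite rnormM rnormR rnorm_cis mulr1 gtr0_norm.
have := poisson_ineq (hol_dot (f a) hf) rho0 rhor ar.
rewrite dotxx rnormR ger0_norm ?sqr_ge0// expr2 mulrA => H.
rewrite -(ler_pM2r n0) (le_trans H)// [leRHS]mulrC -circZ; last first.
  move=> t; apply: cvgM; last exact: continuous_poisson.
  by apply: cvg_rnorm; exact: cf.
apply: le_circ.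
- move=> t; apply: cvgM; last exact: continuous_poisson.
  by apply: cvg_rnorm; apply: cvg_dot; [exact: cf|exact: cvg_cst].
- move=> t; apply: cvgM; first exact: cvg_cst.
  apply: cvgM; last exact: continuous_poisson.
  by apply: cvg_rnorm; exact: cf.
- move=> t _ _; rewrite mulrA ler_wpM2r ?poisson_ge0// [leRHS]mulrC.
  exact: cauchy_schwarz.
Qed.

End Poisson.

(** * Mean squares over circles *)

Section MeanSquare.
Variables (R : realType) (E : hilbertType R).
Local Notation C := R[i].
Variables (f : C -> E) (Q : C -> C -> E).
Hypothesis hf : hol 1 f Q.

Lemma rnorm_circle (r t : R) : 0 <= r -> rnorm (r%:C * cis t : C) = r.
Proof. by move=> r0; rewrite rnormM rnormR rnorm_cis mulr1 ger0_norm. Qed.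

Lemma continuous_on_circle (r : R) : 0 <= r -> r < 1 ->
  continuous (fun t => f (r%:C * cis t)).
Proof.
move=> r0 r1 t; apply: (hol_cvg hf); last exact: continuous_circle.
by rewrite rnorm_circle.
Qed.

Definition corr (r s : R) :=
  circ (fun t => Re '[f (r%:C * cis t), f (s%:C * cis t)]).

Definition msq (r : R) := circ (fun t => rnorm (f (r%:C * cis t)) ^+ 2).

Lemma corr_msq r : corr r r = msq r.
Proof. by apply: eq_circ => t; rewrite dotxx. Qed.

(** With z = l exp(it), the pairing of f (r z) with f (s / conj z) is
    holomorphic in z, so its mean over the circle |z| = l does not depend
    on l. *)
Lemma corr_scale (r s l : R) : 0 < r -> r < 1 -> 0 < s -> s < 1 ->
  s < l -> r * l < 1 -> corr (r * l) (s / l) = corr r s.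
Proof.
move=> r0 r1 s0 s1 sl rl.
have [q [q1 q2 q3]] := @cis_quotient R.
pose p (c t : R) : C := c%:C * cis t.
have I_ l0 : l0 \in `]s, r^-1[ -> [/\ 0 < l0, 0 < r * l0 < 1 & 0 < s / l0 < 1].
  rewrite in_itv/= => /andP[sl0 l0r]; have l00 : 0 < l0 by apply: lt_trans sl0.
  split=> //; first by rewrite mulr_gt0//= mulrC -ltr_pdivlMr// div1r.
  by rewrite divr_gt0//= ltr_pdivrMr// mul1r.
have cp (T : Type) (G : set_system T) (FG : Filter G) (c t : T -> R) (c0 t0 : R) :
    c @ G --> c0 -> t @ G --> t0 -> p (c x) (t x) @[x --> G] --> p c0 t0.
  by move=> cc tt; exact: cvg_circle.
have pn c t : 0 < c < 1 -> rnorm (p c t) < 1.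
  by move=> /andP[c0 c1]; rewrite rnorm_circle// ltW.
pose K l t := Re '[f (p (r * l) t), f (p (s / l) t)].
pose D l' l t :=
  r * Re '[cis t *: Q (p (r * l') t) (p (r * l) t), f (p (s / l') t)]
  - s / (l * l') * Re '[f (p (r * l) t), cis t *: Q (p (s / l') t) (p (s / l) t)].
have lI : l \in `]s, r^-1[.
  by rewrite in_itv/= sl/= -div1r ltr_pdivlMr// mulrC.
have oneI : 1 \in `]s, r^-1[ by rewrite in_itv/= s1/= invf_gt1.
rewrite -[LHS]/(circ (K l)).
transitivity (circ (K 1)); last by rewrite /K mulr1 divr1.
have cmul (T : Type) (G : set_system T) (FG : Filter G) (c : T -> R) (c0 d : R) :
    c @ G --> c0 -> (d * c x) @[x --> G] --> d * c0.
  by move=> cc; apply: cvgM => //; exact: cvg_cst.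
have cinv (T : Type) (G : set_system T) (FG : Filter G) (c : T -> R) (c0 d : R) :
    c0 != 0 -> c @ G --> c0 -> (d / c x) @[x --> G] --> d / c0.
  by move=> c00 cc; apply: cmul; apply: cvgV.
apply: (@circ_const _ K D s r^-1) => //.
- move=> l0 /I_[l00 rl0 sl0] t; apply: cvg_Re; apply: cvg_dot.
    by apply: continuous_on_circle; case/andP: rl0 => // /ltW.
  by apply: continuous_on_circle; case/andP: sl0 => // /ltW.
- move=> l' l0 t /I_[l'0 rl' sl'] /I_[l00 rl0 sl0].
  rewrite /K (_ : forall a b c d : E, Re '[a, b] - Re '[c, d] =
    Re '[a - c, b] + Re '[c, b - d]); last first.
    by move=> a b c d; rewrite -Re_sub -Re_add dotBl dotBr; congr Re; ring.
  rewrite !(hf.1 _ _ (pn _ _ _) (pn _ _ _))//.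
  rewrite (_ : p (r * l') t - p (r * l0) t = ((l' - l0) * r)%:C * cis t); last first.
    by rewrite /p -mulrBl -real_complexB; congr (_%:C * _); ring.
  rewrite (_ : p (s / l') t - p (s / l0) t =
      (- ((l' - l0) * (s / (l0 * l'))))%:C * cis t); last first.
    rewrite /p -mulrBl -real_complexB; congr (_%:C * _); field.
    by rewrite !gt_eqF.
  rewrite -!scalerA dotZl dotZr conjc_real !Re_scale /D; ring.
- move=> l0 t /I_[l00 rl0 sl0]; have l0n : l0 != 0 by rewrite gt_eqF.
  have c1 : x.1 @[x --> (l0, t)] --> l0 by exact: cvg_fst.
  have c2 : x.2 @[x --> (l0, t)] --> t by exact: cvg_snd.
  have cQ (c : R -> R) : c x @[x --> l0] --> c l0 -> 0 < c l0 < 1 ->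
      cis x.2 *: Q (p (c x.1) x.2) (p (c l0) x.2) @[x --> (l0, t)] -->
      cis t *: Q (p (c l0) t) (p (c l0) t).
    move=> cc c01; have cc1 : c x.1 @[x --> (l0, t)] --> c l0.
      exact: (cvg_comp _ _ c1 cc).
    apply: cvgZ; first exact: (cvg_comp _ _ c2 (@continuous_cis R t)).
    apply: (hol_cvgQ hf); first exact: pn.
      by apply: cp => //; exact: cvg_snd.
    by apply: cp; [exact: cvg_cst|exact: cvg_snd].
  rewrite /D; apply: cvgB; apply: cvgM.
  + exact: cvg_cst.
  + apply: cvg_Re; apply: cvg_dot.
      by apply: (cQ (fun x => r * x)) => //; apply: cmul; exact: cvg_id.
    apply: (hol_cvg hf); first exact: pn.
    by apply: cp; [apply: cinv => //; exact: cvg_fst|exact: cvg_snd].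
  + apply: cinv; first by rewrite mulf_neq0.
    by apply: cvgM; [exact: cvg_cst|exact: cvg_fst].
  + apply: cvg_Re; apply: cvg_dot.
      apply: (hol_cvg hf); first exact: pn.
      by apply: (cp _ _ _ (fun=> r * l0) snd); [exact: cvg_cst|exact: c2].
    by apply: (cQ (fun x => s / x)) => //; apply: cinv => //; exact: cvg_id.
- move=> l0 lI0; have [l00 rl0 sl0] := I_ _ lI0; have l0n : l0 != 0 by rewrite gt_eqF.
  pose qq t' t := r * Im '[q t' t *: Q (p (r * l0) t') (p (r * l0) t), f (p (s / l0) t')]
   + s / (l0 * l0) * Im '[f (p (r * l0) t), q t' t *: Q (p (s / l0) t') (p (s / l0) t)].
  have qqE t : qq t t = D l0 l0 t.
    by rewrite /qq /D q3 -!scalerA (dotZl 'i%C) (dotZr 'i%C) Im_iM Im_conj_iM mulrN.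
  have cpq (c t : R) : p c t' @[t' --> t] --> p c t.
    by apply: cp; [exact: cvg_cst|exact: cvg_id].
  have cqq t : qq t' t @[t' --> t] --> qq t t.
    apply: cvgD; apply: cvgM; try exact: cvg_cst.
      apply: cvg_Im; apply: cvg_dot.
        apply: cvgZ; first exact: q2.
        by apply: (hol_cvgQ hf); [exact: pn|exact: cpq|exact: cvg_cst].
      by apply: (hol_cvg hf); [exact: pn|exact: cpq].
    apply: cvg_Im; apply: cvg_dot; first exact: cvg_cst.
    apply: cvgZ; first exact: q2.
    by apply: (hol_cvgQ hf); [exact: pn|exact: cpq|exact: cvg_cst].
  have cqqd : continuous (fun t => qq t t).
    rewrite (_ : (fun t => qq t t) = D l0 l0); last exact/funext.
    move=> t; apply: cvgB; apply: cvgM; try exact: cvg_cst.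
      apply: cvg_Re; apply: cvg_dot.
        apply: cvgZ; first exact: continuous_cis.
        by apply: (hol_cvgQ hf); [exact: pn|exact: cpq|exact: cpq].
      by apply: (hol_cvg hf); [exact: pn|exact: cpq].
    apply: cvg_Re; apply: cvg_dot.
      by apply: (hol_cvg hf); [exact: pn|exact: cpq].
    apply: cvgZ; first exact: continuous_cis.
    by apply: (hol_cvgQ hf); [exact: pn|exact: cpq|exact: cpq].
  rewrite -(eq_circ qqE).
  apply: (@circ_deriv _ (fun t => l0^-1 * Im '[f (p (r * l0) t), f (p (s / l0) t)])) => //.
    move=> t' t; rewrite -mulrBr (_ : forall a b c d : E, Im '[a, b] - Im '[c, d] =
      Im '[a - c, b] + Im '[c, b - d]); last first.
      by move=> a b c d; rewrite -Im_sub -Im_add dotBl dotBr; congr Im; ring.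
    rewrite !(hf.1 _ _ (pn _ _ _) (pn _ _ _))//.
    have pE c : p c t' - p c t = (c * (t' - t))%:C * q t' t.
      by rewrite real_complexM -mulrA -q1 /p; ring.
    rewrite !pE -!scalerA dotZl dotZr conjc_real !Im_scale /qq.
    by field.
  by rewrite /p cis_2pi.
Qed.

End MeanSquare.

Section MeanSquareLimit.
Variables (R : realType) (E : hilbertType R).
Local Notation C := R[i].
Variables (f : C -> E) (Q : C -> C -> E).
Hypothesis hf : hol 1 f Q.

Lemma continuous_rnorm_circle (r : R) : 0 <= r -> r < 1 ->
  continuous (fun t => rnorm (f (r%:C * cis t))).
Proof.
by move=> r0 r1 t; apply: cvg_rnorm; exact: (continuous_on_circle hf).
Qed.

Lemma continuous_sqr_rnorm_circle (r : R) : 0 <= r -> r < 1 ->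
  continuous (fun t => rnorm (f (r%:C * cis t)) ^+ 2).
Proof.
move=> r0 r1 t; rewrite /continuous_at.
by apply: cvgM; exact: continuous_rnorm_circle.
Qed.

(** By corr_scale both radii can be moved to their geometric mean. *)
Lemma corr_geo (r s : R) : 0 < r -> r < 1 -> 0 < s -> s < 1 ->
  corr f r s = msq f (Num.sqrt (r * s)).
Proof.
move=> r0 r1 s0 s1.
set l := Num.sqrt (s / r).
have l0 : 0 < l by rewrite sqrtr_gt0 divr_gt0.
have lE : l ^+ 2 = s / r by rewrite sqr_sqrtr// divr_ge0// ltW.
have rl : r * l = Num.sqrt (r * s).
  apply/eqP; rewrite -(eqrXn2 (n := 2))// ?sqrtr_ge0// ?mulr_ge0 ?(ltW r0) ?(ltW l0)//.
  rewrite exprMn lE sqr_sqrtr ?mulr_ge0 ?ltW//; apply/eqP; field.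
  by rewrite gt_eqF.
have sl : s / l = r * l.
  apply: (mulIf (x := l)); first by rewrite gt_eqF.
  rewrite divfK ?gt_eqF// -mulrA -expr2 lE; field.
  by rewrite gt_eqF.
rewrite -corr_msq -{2}rl -{1}rl -{2}sl; apply/esym.
have sl1 : s / l < 1.
  rewrite sl rl -[ltRHS]sqrtr1 ltr_sqrt//; nra.
apply: (corr_scale hf) => //; first by move: sl1; rewrite ltr_pdivrMr// mul1r.
by rewrite -sl.
Qed.

Lemma circ_dist_sqr (r s : R) : 0 < r -> r < 1 -> 0 < s -> s < 1 ->
  circ (fun t => rnorm (f (r%:C * cis t) - f (s%:C * cis t)) ^+ 2) =
  msq f r + msq f s - 2 * msq f (Num.sqrt (r * s)).
Proof.
move=> r0 r1 s0 s1.
have cd x y : 0 < x -> x < 1 -> 0 < y -> y < 1 ->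
    continuous (fun t => Re '[f (x%:C * cis t), f (y%:C * cis t)]).
  move=> x0 x1 y0 y1 t; apply: cvg_Re; apply: cvg_dot;
    by apply: (continuous_on_circle hf) => //; exact: ltW.
have cs x : 0 < x -> x < 1 -> continuous (fun t => rnorm (f (x%:C * cis t)) ^+ 2).
  by move=> x0 x1; apply: continuous_sqr_rnorm_circle => //; exact: ltW.
under eq_circ do rewrite rnormB_sqr.
rewrite -corr_geo// /corr -circZ; last exact: cd.
rewrite circB ?circD//; try exact: cs.
  by move=> t; apply: cvgD; exact: cs.
by move=> t; apply: cvgM; [exact: cvg_cst|exact: cd].
Qed.

Lemma msq_ge0 r : 0 <= msq f r.
Proof. by apply: Rintegral_ge0 => t _; exact: sqr_ge0. Qed.

Variable B : R.
Hypothesis fB : forall r, 0 < r -> r < 1 -> msq f r <= B.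

Lemma msq_convex (r s : R) : 0 < r -> r < 1 -> 0 < s -> s < 1 ->
  2 * msq f (Num.sqrt (r * s)) <= msq f r + msq f s.
Proof.
move=> r0 r1 s0 s1; rewrite -subr_ge0 -circ_dist_sqr//.
by apply: Rintegral_ge0 => t _; exact: sqr_ge0.
Qed.

(** If msq f r2 < msq f r1 with r1 < r2, then by convexity in log r the values
    of msq f grow at least linearly along the geometric sequence
    r2 (r1 / r2) ^ k, beyond the bound B. *)
Lemma msq_mono (r1 r2 : R) : 0 < r1 -> r1 < r2 -> r2 < 1 -> msq f r1 <= msq f r2.
Proof.
move=> r10 r12 r21; rewrite leNgt; apply/negP => lt21.
set d := msq f r1 - msq f r2; have d0 : 0 < d by rewrite subr_gt0.
pose q := r1 / r2.
have r20 : 0 < r2 by apply: lt_trans r12.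
have q0 : 0 < q by rewrite divr_gt0.
have q1 : q < 1 by rewrite ltr_pdivrMr// mul1r.
pose y k := r2 * q ^+ k.
have y0 k : 0 < y k by rewrite mulr_gt0// exprn_gt0.
have y1 k : y k < 1.
  apply: le_lt_trans r21; rewrite ler_piMr ?(ltW r20)// exprn_ile1//; exact: ltW.
have yS k : msq f (y k) + d <= msq f (y k.+1).
  elim: k => [|k ih].
    rewrite /y expr0 expr1 mulr1 /q mulrC divfK ?gt_eqF//.
    by rewrite /d addrC subrK.
  have := msq_convex (y0 k) (y1 k) (y0 k.+2) (y1 k.+2).
  rewrite (_ : Num.sqrt _ = y k.+1); last first.
    rewrite (_ : y k * y k.+2 = y k.+1 ^+ 2); last by rewrite /y !exprS; ring.
    by rewrite sqrtr_sqr gtr0_norm.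
  by move: ih; lra.
have yk k : k%:R * d <= msq f (y k).
  elim: k => [|k ih]; first by rewrite mul0r msq_ge0.
  by rewrite (le_trans _ (yS k))// -natr1 mulrDl mul1r lerD2r.
have := archi_boundP (divr_ge0 (le_trans (msq_ge0 _) (fB (y0 0%N) (y1 0%N))) (ltW d0)).
rewrite ltr_pdivrMr// => /lt_le_trans/(_ (yk _)).
by rewrite ltNge fB.
Qed.

(** By circ_dist_sqr the mean square distance of two circles is a second
    difference of msq f, which is monotone and bounded, hence close to its
    supremum near the boundary. *)
Lemma circ_dist_small (e : R) : 0 < e -> exists2 r0 : R, 0 < r0 < 1 &
  forall r s, r0 < r -> r < 1 -> r0 < s -> s < 1 ->
    circ (fun t => rnorm (f (r%:C * cis t) - f (s%:C * cis t)) ^+ 2) <= e.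
Proof.
move=> e0.
pose S := [set msq f r | r in `]0, 1[].
have hS : has_sup S.
  split; first by exists (msq f 2^-1), 2^-1 => //=; rewrite in_itv/=; lra.
  by exists B => _ [r /=] + <-; rewrite in_itv/= => /andP[r0 r1]; exact: fB.
have e20 : 0 < e / 2 by rewrite divr_gt0.
have [_ [r0 r0I <-] Sr0] := sup_adherent e20 hS.
move: r0I; rewrite /= in_itv/= => /andP[r00 r01].
exists r0; first by rewrite r00.
move=> r s rr0 r1 sr0 s1.
have r_gt0 : 0 < r by apply: lt_trans rr0.
have s_gt0 : 0 < s by apply: lt_trans sr0.
have up x : 0 < x -> x < 1 -> msq f x <= sup S.
  by move=> x0 x1; apply: sup_upper_bound => //; exists x => //=; rewrite in_itv/= x0.
rewrite circ_dist_sqr//.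
have h1 := up _ r_gt0 r1; have h2 := up _ s_gt0 s1.
have : msq f r0 <= msq f (Num.sqrt (r * s)).
  apply: msq_mono => //.
    rewrite -[ltLHS](gtr0_norm r00) -sqrtr_sqr ltr_sqrt ?mulr_gt0//.
    by rewrite expr2; nra.
  by rewrite -[ltRHS]sqrtr1 ltr_sqrt//; nra.
by move: Sr0 h1 h2; lra.
Qed.

End MeanSquareLimit.

(** * Domination of Poisson integrals by averages *)

Section KernelBound.
Variable R : realType.
Local Notation C := R[i].
Local Notation mu := (@lebesgue_measure R).

(** Near 0 this is the derivative of the sine, and further away the sine is
    bounded below by compactness. *)
Lemma sin_lower (e : R) : 0 < e -> e < pi -> exists2 c : R, 0 < c &
  forall x, 0 <= x -> x <= pi - e -> c * x <= sin x.
Proof.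
move=> e0 epi.
have [q [q1 q2 q3]] := @derive_quotient R sin cos (@is_derive_sin R).
have : \forall x \near (0 : R), 2^-1 < q x 0.
  by apply: (cvgr_gt _ (q2 0)); rewrite q3 cos0 invf_lt1// ltr1n.
move=> /nbhs_ballP[d /= d0 dq].
have [x0|d1] := leP (pi - e) (d / 2).
  exists 2^-1 => // x x1 xe.
  have := dq x; rewrite /ball/= sub0r normrN => /(_ _)/ltW h.
  have := q1 x 0; rewrite sin0 !subr0 => ->; rewrite mulrC ler_wpM2l//.
  by apply: h; rewrite ger0_norm// (le_lt_trans xe)// (le_lt_trans x0)//; lra.
have [x0 x0I sx0] := EVT_min (ltW d1)
  (@continuous_subspaceT _ _ _ _ (@continuous_sin R)).
have s0 : 0 < sin x0.
  apply: sin_gt0_pi; move: x0I; rewrite in_itv/= => /andP[h1 h2].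
  by move: d0 e0; lra.
exists (Num.min 2^-1 (sin x0 / pi)).
  by rewrite lt_min invr_gt0 ltr0n/= divr_gt0// pi_gt0.
move=> x xge0 xe; have [xd|dx] := leP x (d / 2).
  have := dq x; rewrite /ball/= sub0r normrN => /(_ _)/ltW h.
  have := q1 x 0; rewrite sin0 !subr0 => ->; rewrite mulrC ler_wpM2l//.
  rewrite (@le_trans _ _ 2^-1)//; first by rewrite ge_min lexx.
  by apply: h; rewrite ger0_norm// (le_lt_trans xd)//; lra.
apply: (@le_trans _ _ (sin x0)); last by apply: sx0; rewrite in_itv/= (ltW dx).
apply: (@le_trans _ _ (sin x0 / pi * pi)); last by rewrite divfK// gt_eqF// pi_gt0.
apply: ler_pM => //.
- by rewrite le_min invr_ge0 ler0n/= divr_ge0// ltW// pi_gt0.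
- by rewrite ge_min lexx orbT.
- by rewrite (le_trans xe)// gerBl ltW.
Qed.

Lemma rnorm_circle_sub (rho s t th : R) :
  rnorm (rho%:C * cis t - s%:C * cis th : C) ^+ 2 =
  (rho - s) ^+ 2 + 4 * (rho * s) * sin (`|t - th| / 2) ^+ 2.
Proof.
have -> : 4 * (rho * s) * sin (`|t - th| / 2) ^+ 2 = 2 * (rho * s) * (1 - cos (t - th)).
  have -> : cos (t - th) = cos (`|t - th| / 2 *+ 2).
    by rewrite -mulr_natr divfK// cos_norm.
  rewrite cos_mulr2n (_ : sin _ ^+ 2 = 1 - cos (`|t - th| / 2) ^+ 2); last first.
    by have := cos2Dsin2 (`|t - th| / 2); lra.
  by ring.
rewrite rnorm_sqr Re_sub Im_sub !Re_scale !Im_scale /= cosB.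
have h1 := cos2Dsin2 t; have h2 := cos2Dsin2 th.
transitivity (rho ^+ 2 * (cos t ^+ 2 + sin t ^+ 2) + s ^+ 2 * (cos th ^+ 2 + sin th ^+ 2)
  - 2 * (rho * s) * (cos t * cos th + sin t * sin th)); first by ring.
by rewrite h1 h2; ring.
Qed.

(** The Poisson kernel depends on the distance on the circle. As long as th
    stays away from the endpoints of the period, this distance is comparable
    to the one on the line, and nothing has to be extended periodically. *)
Lemma poisson_le (e : R) : 0 < e -> e < pi -> exists2 k : R, 0 < k <= 1 &
  forall rho s t th, 2^-1 <= s -> s < rho -> rho < 1 -> 0 <= t -> t <= 2 * pi ->
    e <= th -> th <= 2 * pi - e ->
    poisson rho (s%:C * cis th) t <=
    2 * (rho - s) / ((rho - s) ^+ 2 + k * (t - th) ^+ 2).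
Proof.
move=> e0 epi; have e20 : 0 < e / 2 by rewrite divr_gt0.
have [||c c0 sc] := @sin_lower (e / 2) => //; first by lra.
exists (Num.min 1 (c ^+ 2 / 4)).
  by rewrite lt_min ltr01 ge_min lexx divr_gt0// exprn_gt0.
set k := Num.min _ _.
have k0 : 0 <= k by rewrite le_min ler01 divr_ge0// sqr_ge0.
have kc : 4 * k <= c ^+ 2 by rewrite -ler_pdivlMl// mulrC ge_min lexx orbT.
move=> rho s t th s2 srho rho1 t0 t1 th0 th1.
rewrite /poisson rnorm_circle_sub rnorm_circle; last by lra.
set x := `|t - th| / 2.
have x0 : 0 <= x by rewrite divr_ge0.
have x1 : x <= pi - e / 2.
  by rewrite /x ler_pdivrMr// ler_norml; apply/andP; split; lra.
have sx : (c * x) ^+ 2 <= sin x ^+ 2.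
  rewrite lerXn2r ?nnegrE ?mulr_ge0// ?(ltW c0)//; last exact: sc.
  by rewrite (le_trans _ (sc x x0 x1))// mulr_ge0// ltW.
have xE : (t - th) ^+ 2 = 4 * x ^+ 2.
  by rewrite /x -[LHS]real_normK ?num_real//; field.
have rs : 1 <= 4 * (rho * s) by nra.
have D0 : 0 < (rho - s) ^+ 2 by rewrite exprn_gt0// subr_gt0.
have kx0 : 0 <= k * (t - th) ^+ 2 by rewrite mulr_ge0// sqr_ge0.
have Dle : (rho - s) ^+ 2 + k * (t - th) ^+ 2 <=
    (rho - s) ^+ 2 + 4 * (rho * s) * sin x ^+ 2.
  rewrite lerD2l xE (_ : k * (4 * x ^+ 2) = 4 * k * x ^+ 2); last by ring.
  rewrite (le_trans (ler_wpM2r (sqr_ge0 x) kc))// -exprMn (le_trans sx)//.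
  by rewrite ler_peMl// sqr_ge0.
have P1 : 0 < (rho - s) ^+ 2 + k * (t - th) ^+ 2 by rewrite ltr_pwDl.
have P2 := lt_le_trans P1 Dle.
apply: ler_pM.
- by rewrite subr_ge0; nra.
- by rewrite invr_ge0 ltW.
- by rewrite subr_sqr mulrC; nra.
- by rewrite lef_pV2 ?posrE.
Qed.

Lemma circE (f : R -> R) : continuous f ->
  ((circ f)%:E = \int[mu]_(t in `[0%R, (2 * pi)%R]) (f t)%:E)%E.
Proof.
move=> cf; rewrite /circ /Rintegral fineK//.
exact: integrable_fin_num (circ_integrable cf).
Qed.

Local Notation D := (`[0, 2 * pi]%classic : set R).

(** A radially decreasing kernel is a sum over dyadic balls, so the averages
    of g over balls centred at th control its integral against g. *)
Lemma dyadic_domination (g ker : R -> R) (th d k A : R) :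
  continuous g -> continuous ker -> (forall t, 0 <= g t) -> (forall t, 0 <= ker t) ->
  0 < d -> 0 < k -> k <= 1 -> 0 <= th -> th <= 2 * pi -> 0 <= A ->
  (forall t, 0 <= t -> t <= 2 * pi ->
     ker t <= 2 * d / (d ^+ 2 + k * (t - th) ^+ 2)) ->
  (forall r, 0 < r ->
     (\int[mu]_(y in ball th r) (((g \_ D) y)%:E) <= (2 * r * A)%:E)%E) ->
  circ (fun t => g t * ker t) <= 32 / k * A.
Proof.
move=> cg cker g0 ker0 d0 k0 k1 th0 th1 A0 kerle avg.
pose n := (Num.bound (2 * pi / d)).
have nP t : 0 <= t -> t <= 2 * pi -> `|t - th| < 2 ^+ n * d.
  move=> t0 t1; apply: (@le_lt_trans _ _ (2 * pi)).
    by rewrite ler_norml; apply/andP; split; lra.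
  rewrite -ltr_pdivrMr//; apply: lt_trans (archi_boundP _) _.
    by rewrite divr_ge0// ltW// twopi_gt0.
  by rewrite -natrX ltr_nat ltn_expl.
pose c (j : nat) : R := 8 / k * 4^-1 ^+ j / d.
have c0 j : 0 <= c j.
  by rewrite /c !mulr_ge0// ?invr_ge0 ?(ltW k0) ?(ltW d0)// exprn_ge0// invr_ge0.
pose B (j : nat) := ball th (2 ^+ j * d).
have pointwise t : D t -> g t * ker t <= \sum_(j < n.+1) c j * (g \_ (B j)) t.
  rewrite /= in_itv/= => /andP[t0 t1].
  have ex : exists j, `|t - th| < 2 ^+ j * d by exists n; exact: nP.
  (* The first dyadic ball that contains t carries the whole bound at t. *)
  pose j := ex_minn ex.
  have jP : `|t - th| < 2 ^+ j * d /\ (forall i, `|t - th| < 2 ^+ i * d -> (j <= i)%N).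
    by rewrite /j; case: ex_minnP.
  have jn : (j < n.+1)%N by rewrite ltnS; apply: jP.2; exact: nP.
  rewrite (bigD1 (Ordinal jn))//= -[leLHS]addr0; apply: lerD; last first.
    apply: sumr_ge0 => i _; rewrite mulr_ge0//.
    by rewrite /patch; case: ifP => _ //.
  have -> : (g \_ (B j)) t = g t.
    by rewrite /patch mem_set// /B /ball/= distrC; exact: jP.1.
  rewrite mulrC ler_wpM2r// (le_trans (kerle t t0 t1))//.
  have kt : 0 <= k * (t - th) ^+ 2 by rewrite mulr_ge0 ?sqr_ge0// ltW.
  have d20 : 0 < d ^+ 2 by rewrite exprn_gt0.
  rewrite ler_pdivrMr; last by rewrite ltr_pwDl.
  case jE : j => [|i].
    rewrite /c expr0 mulr1 mulrDr.
    have h1 : 2 * d <= 8 / k / d * d ^+ 2.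
      rewrite (_ : _ / d * _ = 8 / k * d); last by field; rewrite !gt_eqF.
      by rewrite ler_pM2r// ler_pdivlMr//; lra.
    rewrite (le_trans h1)// lerDl mulr_ge0// -[_ / d]mulr1.
    by have := c0 0%N; rewrite /c expr0 !mulr1.
  have ti : 2 ^+ i * d <= `|t - th|.
    rewrite leNgt; apply/negP => /jP.2; rewrite jE.
    by rewrite ltnn.
  have h2 : (2 ^+ i * d) ^+ 2 <= (t - th) ^+ 2.
    by rewrite -[leRHS]real_normK ?num_real// lerXn2r ?nnegrE// mulr_ge0// ?ltW// exprn_gt0.
  apply: (@le_trans _ _ (c i.+1 * (k * (2 ^+ i * d) ^+ 2))).
    rewrite /c exprS exprMn -exprM mulnC exprM (_ : (2 : R) ^+ 2 = 4); last by ring.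
    rewrite exprVn; have : (4 : R) ^+ i != 0 by rewrite expf_neq0.
    move: ((4 : R) ^+ i) => p p0; rewrite le_eqVlt; apply/orP; left; apply/eqP.
    by field; rewrite p0 !gt_eqF.
  apply: ler_wpM2l => //; apply: ler_wpDl; first exact: ltW.
  by apply: ler_wpM2l => //; exact: ltW.
have mB j : measurable (B j).
  by apply: open_measurable; apply: ball_open; rewrite mulr_gt0// exprn_gt0.
have mg : measurable_fun setT g by exact: continuous_measurable_fun.
have mgB j : measurable_fun D (fun t => ((c j) * (g \_ (B j)) t)%:E).
  apply: measurable_funTS; apply/measurable_EFinP; apply: measurable_funM => //.
  apply/(measurable_restrictT _ (mB j)); exact: measurable_funTS.
have cgk : continuous (fun t => g t * ker t).
  by move=> t; apply: cvgM; [exact: cg|exact: cker].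
rewrite -lee_fin circE//.
apply: (@le_trans _ _
    (\int[mu]_(t in D) (\sum_(j < n.+1) (c j * (g \_ (B j)) t)%:E)%R)%E).
  apply: ge0_le_integral => //.
  - by move=> t _; rewrite lee_fin mulr_ge0.
  - by apply: measurable_funTS; apply/measurable_EFinP; exact: continuous_measurable_fun.
  - by apply: emeasurable_sum => j; exact: mgB.
  - by move=> t Dt; rewrite sumEFin lee_fin; exact: pointwise.
rewrite ge0_integral_sum//=; last 2 first.
- by move=> j; exact: mgB.
- by move=> j t _; rewrite lee_fin mulr_ge0// /patch; case: ifP.
apply: (@le_trans _ _ (\sum_(j < n.+1) (16 / k * A * 2^-1 ^+ j)%:E)).
  apply: lee_sum => j _.
  under eq_integral do rewrite EFinM.
  rewrite ge0_integralZl_EFin//; last first.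
  - by apply/measurable_EFinP; apply: measurable_funTS;
      apply/(measurable_restrictT _ (mB j)); exact: measurable_funTS.
  - by move=> t _; rewrite lee_fin /patch; case: ifP.
  rewrite -[X in (_ * X)%E]/(\int[mu]_(t in D) ((EFin \o (g \_ (B j))) t))%E.
  rewrite -restrict_EFin -integral_mkcondr setIC integral_mkcondr restrict_EFin.
  apply: (@le_trans _ _ ((c j)%:E * (2 * (2 ^+ j * d) * A)%:E)%E).
    apply: lee_wpmul2l; first by rewrite lee_fin.
    by apply: avg; rewrite mulr_gt0// exprn_gt0.
  rewrite -EFinM lee_fin le_eqVlt; apply/orP; left; apply/eqP.
  have : (2 : R) ^+ j != 0 by rewrite expf_neq0.
  rewrite /c !exprVn (_ : (4 : R) ^+ j = 2 ^+ j * 2 ^+ j); last first.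
    by rewrite -exprMn; congr (_ ^+ _); ring.
  move: ((2 : R) ^+ j) => p p0; by field; rewrite p0 !gt_eqF.
rewrite sumEFin lee_fin -mulr_sumr (_ : 32 / k * A = 16 / k * A * 2); last by ring.
apply: ler_wpM2l; first by rewrite !mulr_ge0// invr_ge0 ltW.
by rewrite -(big_mkord xpredT (fun j => 2^-1 ^+ j)) sum_half_le.
Qed.

End KernelBound.

(** * Weak type estimate for the radial maximal function *)

Section WeakType.
Variable R : realType.
Local Notation C := R[i].
Local Notation mu := (@lebesgue_measure R).
Local Notation D := (`[0, 2 * pi]%classic : set R).

Lemma HL_maximal_avg (h : R -> R) (th A : R) : (forall t, 0 <= h t) ->
  (HL_maximal h th <= A%:E)%E -> forall r, 0 < r ->
  (\int[mu]_(y in ball th r) (h y)%:E <= (2 * r * A)%:E)%E.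
Proof.
move=> h0 hA r r0.
have : (iavg h (ball th r) <= A%:E)%E.
  apply: le_trans hA; apply: ereal_sup_ubound => /=; exists r => //.
  by rewrite in_itv/= r0.
rewrite /iavg (lebesgue_measure_ball _ (ltW r0)) inver mulrn_eq0/= gt_eqF//.
rewrite lee_pdivrMl; last by rewrite pmulrn_lgt0.
rewrite -EFinM mulr2n (_ : (r + r) * A = 2 * r * A); last by ring.
by apply: le_trans; rewrite le_eqVlt; apply/orP; left; apply/eqP;
  apply: eq_integral => y _; rewrite ger0_norm.
Qed.

Definition big_radius (E : hilbertType R) (f : C -> E) (e rho l : R) : set R :=
  [set t | e <= t <= 2 * pi - e /\
    exists2 s, 2^-1 <= s < rho & l < rnorm (f (s%:C * cis t))].

Lemma open_gt_continuous (g : R -> R) l : continuous g -> open [set t | l < g t].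
Proof.
by move=> cg; apply: (@open_comp _ _ g [set x | l < x]) => // x _; exact: cg.
Qed.

Lemma measurable_big_radius (E : hilbertType R) (f : C -> E) Q e rho l :
  hol 1 f Q -> rho <= 1 -> measurable (big_radius f e rho l).
Proof.
move=> hf rho1.
rewrite (_ : big_radius f e rho l = `[e, 2 * pi - e]%classic `&`
    \bigcup_(s in [set s | 2^-1 <= s < rho]) [set t | l < rnorm (f (s%:C * cis t))]).
  apply: measurableI => //; apply: open_measurable.
  apply: bigcup_open => s /= /andP[s2 srho]; apply: open_gt_continuous.
  apply: (continuous_rnorm_circle hf); last exact: lt_le_trans rho1.
  by apply: le_trans s2; rewrite invr_ge0.
apply/seteqP; split=> t /=; rewrite in_itv/=.
  by case=> et [s sr ls]; split=> //; exists s.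
by case=> et [s sr ls]; split=> //; exists s.
Qed.

(** The Poisson integral of the values of f on the circle of radius rho
    dominates f inside, and the Hardy-Littlewood maximal function dominates
    the Poisson integral. *)
Lemma weak_type_rho (e : R) : 0 < e -> e < pi -> exists2 K : R, 0 < K &
  forall (E : hilbertType R) (f : C -> E) Q, hol 1 f Q ->
  forall rho l : R, 2^-1 < rho -> rho < 1 -> 0 < l ->
  (mu (big_radius f e rho l) <=
   (K / l * circ (fun t => rnorm (f (rho%:C * cis t))))%:E)%E.
Proof.
move=> e0 epi; have [k /andP[k0 k1] kP] := poisson_le e0 epi.
have pi0 := @pi_gt0 R.
exists (48 / (pi * k)); first by rewrite divr_gt0// mulr_gt0.
move=> E f Q hf rho l rho2 rho1 l0.
have rho0 : 0 < rho by apply: lt_trans rho2; rewrite invr_gt0.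
pose g t := rnorm (f (rho%:C * cis t)).
have cg : continuous g by apply: (continuous_rnorm_circle hf) => //; exact: ltW.
have g0 t : 0 <= g t := rnorm_ge0 _.
pose h := g \_ D.
have h0 t : 0 <= h t by rewrite /h /patch; case: ifP.
pose A := pi * l * k / 16.
have A0 : 0 < A by rewrite divr_gt0// !mulr_gt0.
have loch : locally_integrable setT h.
  by apply: integrable_locally_restrict => //; exact: circ_integrable.
have sub : big_radius f e rho l `<=` [set x | (A%:E < HL_maximal h x)%E].
  move=> t [/andP[et te] [s /andP[s2 srho] ls]] /=.
  rewrite ltNge; apply/negP => /(HL_maximal_avg h0) avg.
  have s0 : 0 < s by apply: lt_le_trans s2; rewrite invr_gt0.
  have as_ : rnorm (s%:C * cis t : C) < rho by rewrite rnorm_circle// ltW.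
  have := poisson_ineq_hilbert hf rho0 rho1 as_; apply/negP; rewrite -ltNge.
  apply: (@le_lt_trans _ _ (32 / k * A)).
    apply: (@dyadic_domination _ _ _ t (rho - s)) => //.
    - exact: continuous_poisson.
    - by move=> x; exact: poisson_ge0.
    - by rewrite subr_gt0.
    - by rewrite (le_trans _ et)// ltW.
    - by rewrite (le_trans te)// gerBl ltW.
    - exact: ltW.
    - by move=> x x0 x1; exact: kP.
  rewrite (_ : 32 / k * A = 2 * pi * l); last by rewrite /A; field; rewrite gt_eqF.
  by rewrite ltr_pM2l// mulr_gt0.
apply: (@le_trans _ _ (mu [set x | (A%:E < HL_maximal h x)%E])).
  exact: le_outer_measure.
apply: (le_trans (maximal_inequality loch A0)).
rewrite (_ : (\int[mu]_(y in setT) _)%E = (circ g)%:E).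
  rewrite -EFinM lee_fin le_eqVlt; apply/orP; left; apply/eqP.
  congr (_ * _); rewrite /A; move: pi0; move: (pi : R) => p p0; field.
  by rewrite !gt_eqF.
rewrite circE// [RHS]integral_mkcond; apply: eq_integral => y _.
by rewrite restrict_EFin /= ger0_norm.
Qed.

Lemma near_onem_inv (s : R) : s < 1 -> \forall n \near \oo, s < 1 - n.+2%:R^-1.
Proof.
move=> s1; have s10 : 0 < 1 - s by rewrite subr_gt0.
near=> n; rewrite ltrBrDr -ltrBrDl -[ltRHS]invrK ltf_pV2 ?posrE ?invr_gt0//.
apply: (@le_lt_trans _ _ n%:R); last by rewrite ltr_nat.
by near: n; exact: nbhs_infty_ger.
Unshelve. all: by end_near. Qed.

(** Continuity of the measure along increasing unions removes the restriction
    to radii below rho. *)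
Lemma weak_type (e : R) : 0 < e -> e < pi -> exists2 K : R, 0 < K &
  forall (E : hilbertType R) (f : C -> E) Q, hol 1 f Q ->
  forall l N r0 : R, 0 < l -> r0 < 1 ->
  (forall rho, r0 < rho -> rho < 1 ->
     circ (fun t => rnorm (f (rho%:C * cis t))) <= N) ->
  (mu (big_radius f e 1 l) <= (K / l * N)%:E)%E.
Proof.
move=> e0 epi; have [K K0 KP] := weak_type_rho e0 epi.
exists K => // E f Q hf l N r0 l0 r01 fN.
pose rho (n : nat) : R := 1 - n.+2%:R^-1.
have rho1 n : rho n < 1 by rewrite gtrBl invr_gt0.
have rho_gt s : s < 1 -> \forall n \near \oo, s < rho n by exact: near_onem_inv.
have W1 : big_radius f e 1 l = \bigcup_n big_radius f e (rho n) l.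
  apply/seteqP; split=> t.
    move=> [et [s /andP[s2 s1] ls]].
    have [n ns] : exists n, s < rho n by apply: (@filter_ex _ \oo); exact: rho_gt.
    by exists n => //; split=> //; exists s => //; rewrite s2.
  move=> [n _ [et [s /andP[s2 sr] ls]]]; split=> //; exists s => //.
  by rewrite s2 (lt_trans sr).
have Wn_le n m : (n <= m)%N -> big_radius f e (rho n) l `<=` big_radius f e (rho m) l.
  move=> nm t [et [s /andP[s2 sr] ls]]; split=> //; exists s => //.
  rewrite s2 (lt_le_trans sr)// lerD2l lerN2 lef_pV2 ?posrE// ler_nat.
  by rewrite !ltnS.
have cvgW : mu (big_radius f e (rho n) l) @[n --> \oo] --> mu (big_radius f e 1 l).
  rewrite W1; apply: nondecreasing_cvg_mu.
  - by move=> n; apply: (measurable_big_radius _ _ hf); exact: ltW.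
  - rewrite -W1; exact: (measurable_big_radius _ _ hf).
  - by move=> n m nm; apply/subsetPset; exact: Wn_le.
rewrite -(cvg_lim _ cvgW)//; apply: lime_le; first by apply/cvg_ex; eexists; exact: cvgW.
near=> n.
have rn : Num.max r0 2^-1 < rho n.
  by near: n; apply: rho_gt; rewrite gt_max r01 invf_lt1// ltr1n.
move: rn; rewrite gt_max => /andP[rn r2].
apply: (le_trans (KP _ _ _ hf _ _ r2 (rho1 n) l0)).
by rewrite lee_fin ler_wpM2l ?divr_ge0 ?(ltW K0) ?(ltW l0)// fN.
Unshelve. all: by end_near. Qed.

End WeakType.

(** * Radial limits *)

Section Fatou.
Variables (R : realType) (E : hilbertType R).
Local Notation C := R[i].
Local Notation mu := (@lebesgue_measure R).
Variables (f : C -> E) (Q : C -> C -> E).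
Hypothesis hf : hol 1 f Q.

Lemma rnorm_scale (rho : R) (z : C) : 0 <= rho -> rho <= 1 -> rnorm z < 1 ->
  rnorm (rho%:C * z) < 1.
Proof.
move=> r0 r1 z1; rewrite rnormM rnormR ger0_norm// (le_lt_trans _ z1)//.
by rewrite ler_piMl// rnorm_ge0.
Qed.

Lemma hol_sub_dilate (rho : R) : 0 <= rho -> rho <= 1 ->
  exists P, hol 1 (fun z => f z - f (rho%:C * z)) P.
Proof.
move=> r0 r1; exists (fun z w => Q z w - rho%:C *: Q (rho%:C * z) (rho%:C * w)).
split=> [z w z1 w1|z z1].
  rewrite scalerBr -(hf.1 z w)// scalerA.
  rewrite (_ : (z - w) * rho%:C = rho%:C * z - rho%:C * w); last by rewrite mulrC mulrBr.
  rewrite -hf.1; [|exact: rnorm_scale..].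
  by rewrite !opprB addrACA [RHS]addrACA (addrC (- f (rho%:C * z))).
apply: cvgB; first exact: hf.2.
apply: cvgZ; first exact: cvg_cst.
apply: (hol_cvgQ hf); first exact: rnorm_scale.
  by apply: cvgM; [exact: cvg_cst|exact: cvg_fst_diag].
by apply: cvgM; [exact: cvg_cst|exact: cvg_snd_diag].
Qed.

Variable B : R.
Hypothesis fB : forall r, 0 < r -> r < 1 -> msq f r <= B.

(** The mean square estimate circ_dist_small becomes a bound on means through
    x <= x ^ 2 / (2 k') + k' / 2. *)
Lemma dilate_small (k : R) : 0 < k -> exists rho r0 : R,
  [/\ 0 < rho, rho < 1, r0 < 1 & forall r, r0 < r -> r < 1 ->
    circ (fun t => rnorm (f (r%:C * cis t) - f (rho%:C * (r%:C * cis t)))) <= k].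
Proof.
move=> k0; pose k' := k / (1 + pi).
have pi0 := @pi_gt0 R.
have k'0 : 0 < k' by rewrite divr_gt0// addr_gt0.
have [r0 /andP[r00 r01] H] := circ_dist_small hf fB (exprn_gt0 2 k'0).
pose rho := (1 + r0) / 2.
have rr : r0 < rho by rewrite /rho; lra.
have rho0 : 0 < rho by apply: lt_trans rr.
have rho1 : rho < 1 by rewrite /rho; lra.
exists rho, (r0 / rho); split => //; first by rewrite ltr_pdivrMr// mul1r.
move=> r; rewrite ltr_pdivrMr// mulrC => r0r r1.
have r_r0 : r0 < r by rewrite (lt_trans r0r)//; nra.
have r_gt0 : 0 < r by apply: lt_trans r_r0.
have rhor0 : 0 < rho * r by rewrite mulr_gt0.
have rhor1 : rho * r < 1 by nra.
have := H r (rho * r) r_r0 r1 r0r rhor1.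
have c1 : continuous (fun t => rnorm (f (r%:C * cis t) - f ((rho * r)%:C * cis t))).
  move=> t; apply: cvg_rnorm; apply: cvgB;
    by apply: (continuous_on_circle hf) => //; exact: ltW.
have c2 : continuous (fun t => rnorm (f (r%:C * cis t) - f ((rho * r)%:C * cis t)) ^+ 2).
  by move=> t; apply: cvgM; exact: c1.
move=> HH.
under eq_circ do rewrite mulrA -real_complexM.
apply: (@le_trans _ _ (circ (fun t => k'^-1 / 2 *
   rnorm (f (r%:C * cis t) - f ((rho * r)%:C * cis t)) ^+ 2 + k' / 2))).
  apply: le_circ => //.
    move=> t; apply: cvgD; last exact: cvg_cst.
    by apply: cvgM; [exact: cvg_cst|exact: c2].
  move=> t _ _; set x := rnorm _.
  rewrite -subr_ge0 (_ : _ - x = k'^-1 / 2 * (x - k') ^+ 2).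
    by rewrite mulr_ge0 ?sqr_ge0// divr_ge0// invr_ge0 ltW.
  by field; rewrite gt_eqF.
rewrite circD; [|by move=> t; apply: cvgM; [exact: cvg_cst|exact: c2]|exact: cst_continuous].
rewrite (circ_cst (k' / 2)) circZ//.
apply: (@le_trans _ _ (k'^-1 / 2 * k' ^+ 2 + k' / 2 * (2 * pi))).
  by rewrite lerD2r ler_wpM2l// divr_ge0// invr_ge0 ltW.
rewrite (_ : _ + _ = k' * (2^-1 + pi)); last by field; rewrite gt_eqF.
rewrite /k' -mulrA; apply: ler_piMr; first exact: ltW.
rewrite mulrC ler_pdivrMr; last exact: addr_gt0.
by rewrite mul1r lerD2r invf_le1// ler1n.
Qed.

(** The factor 3 leaves room for two errors of size l in replacing f by a
    dilate, and for an oscillation l of the dilate, which is continuous up to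
    the boundary. *)
Definition oscillating (e l : R) : set R :=
  [set t | e <= t <= 2 * pi - e /\ forall r0, r0 < 1 -> exists r s,
    [/\ r0 < r < 1, r0 < s < 1 &
        3 * l < rnorm (f (r%:C * cis t) - f (s%:C * cis t))]].

(** Where f oscillates, f minus a dilate of f is large somewhere on the radius;
    by the weak type estimate this happens on a set whose measure is as small
    as desired, since the dilate may be chosen close to f in the mean. *)
Lemma oscillating_null (e l : R) : 0 < e -> e < pi -> 0 < l ->
  mu.-negligible (oscillating e l).
Proof.
move=> e0 epi l0; have [K K0 KP] := weak_type e0 epi.
have step (n : nat) : exists W, [/\ measurable W, oscillating e l `<=` W &
    (mu W <= (n.+1%:R^-1)%:E)%E].
  have k0 : 0 < l / K / n.+1%:R by rewrite !divr_gt0.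
  have [rho [r0 [rho0 rho1 r01 small]]] := dilate_small k0.
  have [P hg] := hol_sub_dilate (ltW rho0) (ltW rho1).
  exists (big_radius (fun z => f z - f (rho%:C * z)) e 1 l); split.
  - exact: (measurable_big_radius _ _ hg).
  - move=> t [et osc]; split=> //.
    have cf : f (rho%:C * (r%:C * cis t)) @[r --> (1 : R)] --> f (rho%:C * cis t).
      have -> : rho%:C * cis t = rho%:C * (1%:C * cis t) :> C by rewrite mul1r.
      apply: (hol_cvg hf); first by rewrite mul1r rnorm_circle// ltW.
      apply: cvgM; first exact: cvg_cst.
      by apply: cvg_circle; [exact: cvg_id|exact: cvg_cst].
    have l20 : 0 < l / 2 by rewrite divr_gt0.
    have : \forall r \near (1 : R),
        rnorm (f (rho%:C * (r%:C * cis t)) - f (rho%:C * cis t)) < l / 2.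
      by move/cvg_rnormP : cf; exact.
    move=> /nbhs_ballP[d /= d0 dP].
    have [|r [s [/andP[rl r1] /andP[sl s1] ls]]] := osc (Num.max 2^-1 (1 - d)).
      by rewrite gt_max invf_lt1// ltr1n/= gtrBl.
    move: rl sl; rewrite !gt_max => /andP[r2 rd] /andP[s2 sd].
    have near1 x : 1 - d < x -> x < 1 ->
        rnorm (f (rho%:C * (x%:C * cis t)) - f (rho%:C * cis t)) < l / 2.
      move=> xd x1; apply: dP; rewrite /ball/= ger0_norm; lra.
    apply: contrapT => nex.
    have le x : 2^-1 < x -> x < 1 ->
        rnorm (f (x%:C * cis t) - f (rho%:C * (x%:C * cis t))) <= l.
      move=> x2 x1; rewrite leNgt; apply/negP => lx; apply: nex.
      by exists x => //; rewrite (ltW x2).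
    have := near1 _ rd r1; have := near1 _ sd s1; have := le _ r2 r1; have := le _ s2 s1.
    set a := f (r%:C * _) in ls *; set b := f (s%:C * _) in ls *.
    set a' := f (rho%:C * (r%:C * _)); set b' := f (rho%:C * (s%:C * _)).
    set c := f (rho%:C * cis t) => h1 h2 h3 h4.
    have t1 := rnorm_trans a b a'; have t2 := rnorm_trans a' b c.
    have t3 := rnorm_trans c b b'.
    by rewrite (rnormC b' b) in t3; rewrite (rnormC b' c) in h3; lra.
  - apply: (le_trans (KP _ _ _ hg _ _ _ l0 r01 small)).
    rewrite lee_fin (_ : K / l * _ = n.+1%:R^-1)//; field.
    by rewrite !gt_eqF.
have [W WP] := choice step.
exists (\bigcap_n W n); split.
- by apply: bigcapT_measurable => n; have [] := WP n.
- apply/eqP; rewrite eq_le measure_ge0 andbT; apply/lee_addgt0Pr => x x0.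
  rewrite add0e.
  have [n nx] := ex_invS_lt x0.
  have [mW _ Wn] := WP n.
  apply: (@le_trans _ _ (mu (W n))).
    by apply: le_outer_measure; exact: bigcap_inf.
  by rewrite (le_trans Wn)// lee_fin ltW.
- by move=> t to n _; have [_ + _] := WP n; apply.
Qed.

Lemma negligible_set1 (x : R) : mu.-negligible [set x].
Proof.
by apply/negligibleP; [exact: measurable_set1|exact: lebesgue_measure_set1].
Qed.

Lemma ae_circleP (P : C -> Prop) :
  (forall n, mu.-negligible
     [set t | n.+1%:R^-1 <= t <= 2 * pi - n.+1%:R^-1 /\ ~ P (cis t)]) ->
  ae_circle P.
Proof.
move=> nP; rewrite /ae_circle /almost_everywhere /=.
apply: (@negligibleS _ _ _ mu ([set 0] `|` ([set 2 * pi] `|`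
    \bigcup_n [set t | n.+1%:R^-1 <= t <= 2 * pi - n.+1%:R^-1 /\ ~ P (cis t)]))).
  move=> t /= /not_implyP[]; rewrite in_itv/= => /andP[t0 t1] nPt.
  have [t0'|t0'] := eqVneq t 0; first by left.
  have [t1'|t1'] := eqVneq t (2 * pi); first by right; left.
  right; right.
  have {t0 t0'}t0 : 0 < t by rewrite lt_neqAle eq_sym t0'.
  have {t1 t1'}t1 : 0 < 2 * pi - t by rewrite subr_gt0 lt_neqAle t1'.
  pose m := Num.min t (2 * pi - t); have m0 : 0 < m by rewrite lt_min t0.
  have [n nm] := ex_invS_lt m0.
  exists n => //; split=> //; move: nm; rewrite lt_min => /andP[n1 n2].
  by rewrite (ltW n1)/= lerBrDr -lerBrDl ltW.
apply: negligibleU; first exact: negligible_set1.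
apply: negligibleU; first exact: negligible_set1.
exact: negligible_bigcup.
Qed.

(** Fatou's theorem: off the null sets of oscillation the values of f along a
    radius form a Cauchy filter, and E is complete. *)
Lemma fatou : ae_circle (fun z => cvg (f (r%:C * z) @[r --> (1 : R)^'-])).
Proof.
apply: ae_circleP => n; set e := n.+1%:R^-1.
have e0 : 0 < e :> R by rewrite invr_gt0.
have epi : e < pi.
  by rewrite (@le_lt_trans _ _ 1)// ?invf_le1// ?ler1n//; have := @pi_ge2 R; lra.
apply: (@negligibleS _ _ _ mu (\bigcup_k oscillating e k.+1%:R^-1)); last first.
  by apply: negligible_bigcup => k; apply: oscillating_null; rewrite // invr_gt0.
move=> t [et ncv]; apply: contrapT => nosc; apply: ncv.
apply: cauchy_cvg; apply: cauchy_exP => eps eps0.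
have /complex_realP[x xE] : eps \is Num.real by apply: gtr0_real.
move: eps0; rewrite {}xE ltcR => x0.
have [k kx] : exists k : nat, 3 * k.+1%:R^-1 < x.
  exists (Num.bound (3 / x)); rewrite ltr_pdivrMr// mulrC -ltr_pdivrMr//.
  apply: lt_trans (archi_boundP _) _; first by rewrite divr_ge0// ltW.
  by rewrite ltr_nat.
have : ~ oscillating e k.+1%:R^-1 t by move=> osc; apply: nosc; exists k.
move=> /not_andP[//|] /existsNP[r0 /not_implyP[r01 nosc']].
pose s := (Num.max 0 r0 + 1) / 2.
have s0 : r0 < s < 1.
  have m1 : Num.max 0 r0 < 1 by rewrite gt_max ltr01.
  have m2 : r0 <= Num.max 0 r0 by rewrite le_max lexx orbT.
  by rewrite /s; apply/andP; split; lra.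
exists (f (s%:C * cis t)).
suff H : \forall r \near (1 : R)^'-, ball (f (s%:C * cis t)) x%:C (f (r%:C * cis t)).
  exact: H.
near=> r.
rewrite -ball_normE /ball_/= rnormE ltcR (le_lt_trans _ kx)//.
rewrite leNgt; apply/negP => big; apply: nosc'; exists s, r; split=> //.
by apply/andP; split; near: r; [exact: nbhs_left_gt|exact: nbhs_left_lt].
Unshelve. all: by end_near. Qed.

End Fatou.

(** * The Herglotz integral of a compact set of angles *)

Section CompactIntegral.
Variables (R : realType) (V : set R).
Hypothesis cV : compact V.
Local Notation C := R[i].
Local Notation mu := (@lebesgue_measure R).

Lemma compact_measurable_R : measurable (V : set (measurableTypeR R)).
Proof. by apply: closed_measurable; apply: compact_closed => //; exact: Rhausdorff. Qed.

Let mV := compact_measurable_R.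

Lemma Rint_integrable (f : R -> R) : continuous f -> mu.-integrable V (EFin \o f).
Proof. exact: continuous_integrable. Qed.

Lemma compact_fin_measure : (mu V < +oo)%E.
Proof.
have /integrableP[_] := Rint_integrable (@cst_continuous _ _ (1 : R)).
by under eq_integral do rewrite /= normr1; rewrite integral_cst// mul1e.
Qed.

Lemma Rint_bound (f : R -> R) (e : R) : continuous f ->
  (forall t, V t -> `|f t| <= e) -> `|\int[mu]_(t in V) f t| <= e * fine (mu V).
Proof.
move=> cf fe; have h := le_normr_Rintegral mV (Rint_integrable cf).
apply: (le_trans h).
rewrite -Rintegral_cst//; apply: le_Rintegral => //.
  by apply: Rint_integrable => t; apply: cvg_norm; exact: cf.
exact: (Rint_integrable (@cst_continuous _ _ e)).
Qed.

Lemma cvg_Rint (T : topologicalType) (G : T -> R -> R) (p0 : T) :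
  (\forall p \near p0, continuous (G p)) ->
  (forall t, V t -> G q.1 q.2 @[q --> (p0, t)] --> G p0 t) ->
  \int[mu]_(t in V) G p t @[p --> p0] --> \int[mu]_(t in V) G p0 t.
Proof.
move=> cG jG; apply/cvgrPdistC_le => e e0.
have cG0 := nbhs_singleton cG.
have d0 : 0 < e / (fine (mu V) + 1).
  by rewrite divr_gt0// ltr_wpDl// fine_ge0.
have U := unif_near cV jG d0.
near=> p.
have cp : continuous (G p) by near: p; exact: cG.
rewrite -RintegralB//; [|exact: Rint_integrable..].
apply: (@le_trans _ _ (e / (fine (mu V) + 1) * fine (mu V))).
  apply: Rint_bound => [t|t Vt]; first by apply: cvgB; [exact: cp|exact: cG0].
  apply: ltW; have : forall t, V t -> `|G p t - G p0 t| < e / (fine (mu V) + 1).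
    by near: p; exact: U.
  exact.
rewrite -mulrA ler_piMr ?(ltW e0)// mulrC ler_pdivrMr ?mul1r ?lerDl//.
by rewrite ltr_wpDl// fine_ge0.
Unshelve. all: by end_near. Qed.

Definition cint (g : R -> C) : C :=
  (\int[mu]_(t in V) Re (g t)) +i* (\int[mu]_(t in V) Im (g t)).

Lemma cintB (g h : R -> C) : continuous g -> continuous h ->
  cint (fun t => g t - h t) = cint g - cint h.
Proof.
move=> cg ch; rewrite /cint; apply: complex_ext; rewrite ?Re_sub ?Im_sub/= -RintegralB//.
- by apply: eq_Rintegral => t _; rewrite Re_sub.
- by apply: Rint_integrable => t; apply: cvg_Re; exact: cg.
- by apply: Rint_integrable => t; apply: cvg_Re; exact: ch.
- by apply: eq_Rintegral => t _; rewrite Im_sub.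
- by apply: Rint_integrable => t; apply: cvg_Im; exact: cg.
- by apply: Rint_integrable => t; apply: cvg_Im; exact: ch.
Qed.

Lemma cintZ (c : C) (g : R -> C) : continuous g ->
  cint (fun t => c * g t) = c * cint g.
Proof.
move=> cg.
have cRe : continuous (fun t => Re (g t)) by move=> t; apply: cvg_Re; exact: cg.
have cIm : continuous (fun t => Im (g t)) by move=> t; apply: cvg_Im; exact: cg.
have iRe x : mu.-integrable V (EFin \o (fun t => x * Re (g t))).
  by apply: Rint_integrable => t; apply: cvgM; [exact: cvg_cst|exact: cRe].
have iIm x : mu.-integrable V (EFin \o (fun t => x * Im (g t))).
  by apply: Rint_integrable => t; apply: cvgM; [exact: cvg_cst|exact: cIm].
have R_ := Rint_integrable cRe; have I_ := Rint_integrable cIm.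
apply: complex_ext; rewrite ?Re_mul ?Im_mul /= -!RintegralZl//.
  by rewrite -RintegralB//; apply: eq_Rintegral => t _; rewrite Re_mul.
by rewrite -RintegralD//; apply: eq_Rintegral => t _; rewrite Im_mul.
Qed.

Lemma cvg_cint (T : topologicalType) (G : T -> R -> C) (p0 : T) :
  (\forall p \near p0, continuous (G p)) ->
  (forall t, V t -> G q.1 q.2 @[q --> (p0, t)] --> G p0 t) ->
  cint (G p) @[p --> p0] --> cint (G p0).
Proof.
move=> cG jG; apply: cvg_ReIm => /=; apply: cvg_Rint.
- near=> p => t; apply: cvg_Re.
  have cp : continuous (G p) by near: p; exact: cG.
  exact: cp.
- by move=> t Vt; apply: cvg_Re; exact: jG.
- near=> p => t; apply: cvg_Im.
  have cp : continuous (G p) by near: p; exact: cG.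
  exact: cp.
- by move=> t Vt; apply: cvg_Im; exact: jG.
Unshelve. all: by end_near. Qed.

(** The Herglotz integral of the indicator function of V: a holomorphic
    function whose real part is the Poisson integral of that indicator. *)
Definition herglotz (z : C) : C :=
  (2 * pi)^-1%:C * cint (fun t => 2 * cauchy_kernel 1 z t - 1).

Lemma cvg_cauchy_kernel (T : Type) (F : set_system T) (FF : Filter F)
    (u : T -> C) (v : T -> R) z t : u @ F --> z -> v @ F --> t -> cis t - z != 0 ->
  cauchy_kernel 1 (u x) (v x) @[x --> F] --> cauchy_kernel 1 z t.
Proof.
move=> uz vt tz.
have ce : 1%:C * cis (v x) @[x --> F] --> (1%:C * cis t : C).
  by apply: cvg_circle => //; exact: cvg_cst.
rewrite /cauchy_kernel; apply: cvgM; first exact: ce.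
apply: cvgV; first by rewrite mul1r.
by apply: cvgB; [exact: ce|exact: uz].
Qed.

Lemma cis_sub_neq0 (z : C) t : rnorm z < 1 -> cis t - z != 0.
Proof. by move=> z1; have := circle_neq t z1; rewrite mul1r. Qed.

Lemma hol_herglotz : exists Q, hol 1 herglotz Q.
Proof.
pose q (p : C * C) t := 2 * cauchy_kernel 1 p.1 t * (cis t - p.2)^-1 : C.
have cq (p : C * C) : rnorm p.1 < 1 -> rnorm p.2 < 1 -> continuous (q p).
  move=> p1 p2 t; apply: cvgM.
    apply: cvgM; first exact: cvg_cst.
    exact: continuous_cauchy_kernel.
  apply: cvgV; first exact: cis_sub_neq0.
  by apply: cvgB; [exact: continuous_cis|exact: cvg_cst].
have ck (z : C) : rnorm z < 1 -> continuous (fun t => 2 * cauchy_kernel 1 z t - 1).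
  move=> z1 t.
  have h : (2 * cauchy_kernel 1 z x : C) @[x --> t] --> (2 * cauchy_kernel 1 z t : C).
    by apply: cvgM; [exact: cvg_cst|exact: continuous_cauchy_kernel].
  have h1 : (fun _ : R => - 1 : C) @ t --> (- 1 : C) by exact: cvg_cst.
  have := @cvgD _ C _ _ _ _ _ _ _ h h1.
  apply.
exists (fun z w => (2 * pi)^-1%:C * cint (q (z, w))); split=> [z w z1 w1|z z1].
  have qE : cint (fun t => (2 * cauchy_kernel 1 z t - 1) - (2 * cauchy_kernel 1 w t - 1))
      = (z - w) * cint (q (z, w)).
    rewrite -cintZ; last by apply: cq.
    congr cint; apply/funext => t; rewrite /q /cauchy_kernel /= mul1r.
    have tz := cis_sub_neq0 t z1; have tw := cis_sub_neq0 t w1.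
    by move: (cis t) tz tw => e tz tw; field; rewrite tz tw.
  rewrite /herglotz -mulrBr -cintB; [|exact: ck..].
  by rewrite qE; exact: mulrCA.
apply: cvgM; first exact: cvg_cst.
rewrite (_ : cint (q (z, z)) = (fun p => cint (q p)) (z, z))//.
rewrite (_ : (fun p : C * C => cint (q (p.1, p.2))) = (fun p => cint (q p))); last first.
  by apply/funext => -[].
apply: cvg_cint.
  have n1 := near_rnorm_lt _ z1 (@cvg_fst_diag R z).
  have n2 := near_rnorm_lt _ z1 (@cvg_snd_diag R z).
  by near=> p; apply: cq; near: p; [exact: n1|exact: n2].
move=> t _.
have c1 : x.1.1 @[x --> ((z, z), t)] --> z.
  by apply: (cvg_comp _ _ cvg_fst (@cvg_fst_diag R z)).
have c2 : x.1.2 @[x --> ((z, z), t)] --> z.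
  by apply: (cvg_comp _ _ cvg_fst (@cvg_snd_diag R z)).
have c3 : x.2 @[x --> ((z, z), t)] --> t by exact: cvg_snd.
apply: cvgM.
  apply: cvgM; first exact: cvg_cst.
  by apply: cvg_cauchy_kernel => //; exact: cis_sub_neq0.
apply: cvgV; first exact: cis_sub_neq0.
have c4 : (cis x.2 : C) @[x --> ((z, z), t)] --> (cis t : C).
  exact: (cvg_comp _ _ c3 (@continuous_cis R t)).
by apply: cvgB; [exact: c4|exact: c2].
Unshelve. all: by end_near. Qed.

Lemma Re_herglotz z : rnorm z < 1 ->
  Re (herglotz z) = (2 * pi)^-1 * \int[mu]_(t in V) poisson 1 z t.
Proof.
move=> z1; rewrite /herglotz Re_scale /=; congr (_ * _).
apply: eq_Rintegral => t _; rewrite poisson_cauchy//.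
by rewrite Re_sub Re_mul /=; ring.
Qed.

Hypothesis VD : V `<=` `[0, 2 * pi].

Lemma Re_herglotz_ge0 z : rnorm z < 1 -> 0 <= Re (herglotz z).
Proof.
move=> z1; rewrite Re_herglotz// mulr_ge0//.
  by rewrite invr_ge0 ltW// twopi_gt0.
by apply: Rintegral_ge0 => t _; exact: poisson_ge0.
Qed.

(** The Poisson kernel has mean 1 over the whole circle. *)
Lemma Re_herglotz_le1 z : rnorm z < 1 -> Re (herglotz z) <= 1.
Proof.
move=> z1; rewrite Re_herglotz// ler_pdivrMl ?twopi_gt0// mulr1.
rewrite -(circ_poisson ltr01 z1).
have cp := continuous_poisson z1.
rewrite -lee_fin circE// /Rintegral fineK; last first.
  exact: integrable_fin_num (Rint_integrable cp).
apply: ge0_subset_integral => //.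
  by apply: measurable_funTS; apply/measurable_EFinP; exact: continuous_measurable_fun.
by move=> t _; rewrite lee_fin poisson_ge0.
Qed.

Lemma Re_herglotz_gt0 z : (0 < mu V)%E -> rnorm z < 1 -> 0 < Re (herglotz z).
Proof.
move=> V0 z1; rewrite Re_herglotz// mulr_gt0 ?invr_gt0 ?twopi_gt0//.
pose c := (1 - rnorm z ^+ 2) / 4.
have zn := rnorm_ge0 z.
have c0 : 0 < c by rewrite divr_gt0//; nra.
have cp := continuous_poisson z1.
apply: (@lt_le_trans _ _ (c * fine (mu V))).
  rewrite mulr_gt0// fine_gt0// V0/=; exact: compact_fin_measure.
rewrite -Rintegral_cst//; apply: le_Rintegral => //.
- exact: (Rint_integrable (@cst_continuous _ _ c)).
- exact: Rint_integrable.
move=> t _; rewrite /poisson expr1n /c ler_wpM2l//; first by nra.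
have := rnorm_circle_gt0 t z1; rewrite mul1r => e0.
rewrite lef_pV2 ?posrE ?exprn_gt0//.
have := rnormB (cis t) z; rewrite rnorm_cis; nra.
Qed.

(** At a boundary point off V the Poisson kernel tends to 0 uniformly on V. *)
Lemma Re_herglotz_cvg0 th : (forall t, V t -> cis t - cis th != 0 :> C) ->
  Re (herglotz (r%:C * cis th)) @[r --> (1 : R)^'-] --> (0 : R).
Proof.
move=> tth.
pose G (r t : R) := poisson 1 (r%:C * cis th) t.
have G1 t : G 1 t = 0 by rewrite /G /poisson rnorm_circle// subrr mul0r.
have jG t : V t -> G x.1 x.2 @[x --> ((1 : R), t)] --> G 1 t.
  move=> Vt.
  have c1 : x.1 @[x --> ((1 : R), t)] --> (1 : R) by exact: cvg_fst.
  have c2 : x.2 @[x --> ((1 : R), t)] --> t by exact: cvg_snd.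
  have cz : (x.1%:C * cis th : C) @[x --> ((1 : R), t)] --> (1%:C * cis th : C).
    by apply: cvg_circle => //; exact: cvg_cst.
  have ct : (1%:C * cis x.2 : C) @[x --> ((1 : R), t)] --> (1%:C * cis t : C).
    by apply: cvg_circle => //; exact: cvg_cst.
  apply: cvgM.
    apply: cvgB; first exact: cvg_cst.
    by apply: cvgM; exact: cvg_rnorm cz.
  apply: cvgV.
    rewrite expf_neq0// gt_eqF// rnorm_gt0// !mul1r; apply/eqP; exact: tth.
  have cB : (1%:C * cis x.2 - x.1%:C * cis th : C) @[x --> ((1 : R), t)] -->
      (1%:C * cis t - 1%:C * cis th : C).
    by have := @cvgB _ C _ _ _ _ _ _ _ ct cz; apply.
  have cN := cvg_rnorm _ cB.
  by apply: cvgM; exact: cN.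
apply/cvgrPdistC_le => e e0.
have e'0 : 0 < e * (2 * pi) / (fine (mu V) + 1).
  apply: divr_gt0; first by apply: mulr_gt0 => //; exact: twopi_gt0.
  by rewrite ltr_wpDl// fine_ge0.
have U : \forall r \near (1 : R)^'-, forall t, V t ->
    `|G r t - G 1 t| < e * (2 * pi) / (fine (mu V) + 1).
  by move: (unif_near cV jG e'0); apply: filterS => r + _.
near=> r; have r1 : r < 1 by near: r; exact: nbhs_left_lt.
have r0 : 0 < r by near: r; exact: nbhs_left_gt.
have rn : rnorm (r%:C * cis th : C) < 1 by rewrite rnorm_circle// ltW.
rewrite subr0 Re_herglotz// normrM gtr0_norm ?invr_gt0 ?twopi_gt0//.
rewrite ler_pdivrMl ?twopi_gt0// [leRHS]mulrC.
apply: (@le_trans _ _ (e * (2 * pi) / (fine (mu V) + 1) * fine (mu V))).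
  apply: Rint_bound => [|t Vt]; first exact: (continuous_poisson rn).
  apply: ltW; rewrite -[X in `|X|]subr0 -(G1 t).
  have : forall t, V t -> `|G r t - G 1 t| < e * (2 * pi) / (fine (mu V) + 1).
    by near: r; exact: U.
  exact.
rewrite -mulrA ler_piMr ?(ltW (mulr_gt0 e0 (twopi_gt0 R)))//.
rewrite mulrC ler_pdivrMr ?mul1r ?lerDl//.
by rewrite ltr_wpDl// fine_ge0.
Unshelve. all: by end_near. Qed.

End CompactIntegral.

(** * Boundary uniqueness *)

Section Uniqueness.
Variable R : realType.
Local Notation C := R[i].
Local Notation mu := (@lebesgue_measure R).
Local Notation D := (`[0, 2 * pi]%classic : set R).

Lemma cis_inj (t th : R) : 0 < t -> t < 2 * pi -> 0 <= th -> th <= 2 * pi ->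
  cis t = cis th -> t = th.
Proof.
move=> t0 t1 th0 th1 tE.
have := rnorm_circle_sub 1 1 t th.
rewrite tE subrr rnorm0 subrr => /esym/eqP.
rewrite !expr0n/= add0r !mulr1 mulf_eq0 pnatr_eq0/= expf_eq0/= => /eqP s0.
apply/eqP; rewrite -subr_eq0 -normr_eq0; apply/negP => /negP tth.
have := @sin_gt0_pi R (`|t - th| / 2); rewrite s0 ltxx => H.
apply: notF; apply: H; apply/andP; split.
  by rewrite divr_gt0// normr_gt0 -normr_eq0.
by rewrite ltr_pdivrMr// ltr_norml; apply/andP; split; lra.
Qed.

Lemma bernoulli (x : R) n : 0 <= x -> 1 + n%:R * x <= (1 + x) ^+ n.
Proof.
move=> x0; elim: n => [|n ih]; first by rewrite mul0r addr0 expr0.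
rewrite exprS -natr1 mulrDl mul1r.
have n0 : 0 <= n%:R * x by rewrite mulr_ge0.
by move: x0 ih; nra.
Qed.

(** This Cayley transform is bounded on the strip 0 <= Re w <= 1, has modulus 1
    on the imaginary axis and modulus larger than 1 to its right. *)
Lemma cayley_sqr (w : C) : 0 <= Re w -> Re w <= 1 ->
  rnorm ((2 + w) / (2 - w)) ^+ 2 = 1 + 8 * Re w / rnorm (2 - w) ^+ 2 /\
  1 <= rnorm (2 - w).
Proof.
move=> w0 w1.
have n1 : 1 <= rnorm (2 - w).
  apply: le_trans (Re_le_rnorm _); rewrite Re_sub; move: w1.
  by rewrite (_ : Re (2 : C) = 2)//; lra.
split=> //; rewrite rnormM rnormV exprMn exprVn.
have n0 : rnorm (2 - w) ^+ 2 != 0 by rewrite expf_neq0// gt_eqF// (lt_le_trans _ n1).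
apply: (mulIf n0); rewrite divfK// mulrDl mul1r divfK// !rnorm_sqr.
by case: w {w0 w1 n1 n0} => a b /=; ring.
Qed.

Lemma poisson_bound (rho : R) (a : C) t : rnorm a < 1 ->
  rnorm a + (1 - rnorm a) / 2 < rho -> rho < 1 ->
  poisson rho a t <= 4 / (1 - rnorm a) ^+ 2.
Proof.
move=> a1 rhoa rho1; have a0 := rnorm_ge0 a.
have arho : rnorm a < rho by apply: lt_trans rhoa; rewrite ltrDl divr_gt0// subr_gt0.
have rho0 : 0 <= rho by rewrite ltW// (le_lt_trans a0).
have n0 := rnorm_circle_gt0 t arho.
have n1 : rho - rnorm a <= rnorm (rho%:C * cis t - a).
  have := rnorm_dist (rho%:C * cis t) a.
  by rewrite rnorm_circle// => /(le_trans (ler_norm _)).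
rewrite /poisson ler_pdivrMr ?exprn_gt0// mulrAC ler_pdivlMr; last first.
  by rewrite exprn_gt0// subr_gt0.
move: a1 rhoa rho1 a0 arho rho0 n0 n1.
move: (rnorm (rho%:C * cis t - a)) (rnorm a) => n b a1 rhoa rho1 a0 arho rho0 n0 n1.
have s1 : rho ^+ 2 - b ^+ 2 <= 1 by nra.
have s2 : (1 - b) ^+ 2 <= 4 * n ^+ 2.
  have -> : 4 * n ^+ 2 = (2 * n) ^+ 2 by ring.
  by rewrite lerXn2r ?nnegrE//; lra.
apply: le_trans s2; rewrite -[leRHS]mul1r; apply: ler_wpM2r => //.
exact: sqr_ge0.
Qed.

Variables (h : C -> C) (Qh : C -> C -> C) (M : R) (a : C).
Hypotheses (hh : hol 1 h Qh) (hM : forall z, rnorm z < 1 -> rnorm (h z) <= M).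
Hypotheses (a1 : rnorm a < 1) (ha : h a <> 0).

(* Radial limits along this sequence have a measurable zero set. *)
Let rj (j : nat) : R := 1 - j.+2%:R^-1.

Lemma rj_bounds j : 0 < rj j < 1.
Proof. by rewrite subr_gt0 invf_lt1// ltr1n/= gtrBl invr_gt0. Qed.

Lemma cvg_rj : rj j @[j --> \oo] --> (1 : R)^'-.
Proof.
suff rj1 : rj j @[j --> \oo] --> (1 : R).
  move=> P /= P1; have := rj1 _ P1; rewrite !nbhs_simpl /=.
  by apply: filterS => j; apply; have /andP[] := rj_bounds j.
apply/cvgrPdist_lt => e e0; near=> j; have /andP[_ r1] := rj_bounds j.
rewrite ger0_norm ?subr_ge0 ?(ltW r1)// ltrBlDl -ltrBlDr.
by near: j; apply: near_onem_inv; rewrite gtrBl.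
Unshelve. all: by end_near. Qed.

Section CompactZeros.
Variable V : set R.
Hypotheses (cV : compact V) (VD : V `<=` `]0, 2 * pi[%classic).
Hypothesis (hV : forall t, V t -> h ((rj j)%:C * cis t) @[j --> \oo] --> (0 : C)).

(** If V had positive measure, multiplying h by powers of the Cayley transform
    of the Herglotz integral of V would make the value at a as large as
    desired. The Poisson inequality at a bounds this value by means over
    circles, whose limit is not enlarged: the factor is bounded on V, where h
    tends to 0, and tends to 1 in modulus off V. *)
Lemma compact_zeros_null : mu V = 0%E.
Proof.
apply/eqP; rewrite eq_le measure_ge0 andbT leNgt; apply/negP => V0.
have VD' : V `<=` D.
  by apply: subset_trans VD _; exact: subset_itv_oo_cc.
have mV := compact_measurable_R cV.
pose w := herglotz V.
have [Qw hw] := hol_herglotz cV.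
have w0 z : rnorm z < 1 -> 0 <= Re (w z) by move=> z1; exact: Re_herglotz_ge0.
have w1 z : rnorm z < 1 -> Re (w z) <= 1 by move=> z1; exact: Re_herglotz_le1.
have wa : 0 < Re (w a) by exact: Re_herglotz_gt0.
have den z : rnorm z < 1 -> 2 - w z != 0.
  move=> z1; have [_ n1] := cayley_sqr (w0 z z1) (w1 z z1).
  by apply/eqP => n0; move: n1; rewrite n0 rnorm0 ler10.
have den' z : rnorm z < 1 -> 2 + - 1 * w z != 0 by rewrite mulN1r; exact: den.
pose q z := (2 + w z) / (2 - w z).
have [Qq hq] : exists Q, hol 1 q Q.
  have h1 := hol_add (hol_cst 1 (2 : C)) hw.
  have h2 := hol_add (hol_cst 1 (2 : C)) (hol_mul (hol_cst 1 (- 1 : C)) hw).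
  have h3 := hol_mul h1 (hol_inv h2 den').
  rewrite (_ : q = (fun z => (2 + herglotz V z) * (2 + - 1 * herglotz V z)^-1)).
    by eexists; exact: h3.
  by apply/funext => z; rewrite mulN1r.
have q2 z : rnorm z < 1 -> rnorm (q z) ^+ 2 <= 1 + 8 * Re (w z).
  move=> z1; have [-> n1] := cayley_sqr (w0 z z1) (w1 z z1).
  rewrite lerD2l ler_pdivrMr; last by rewrite exprn_gt0// (lt_le_trans _ n1).
  rewrite ler_peMr ?mulr_ge0 ?w0// exprn_ege1//.
have q9 z : rnorm z < 1 -> rnorm (q z) ^+ 2 <= 9.
  by move=> z1; rewrite (le_trans (q2 z z1))//; have := w1 z z1; lra.
have qa : 1 < rnorm (q a) ^+ 2.
  have [-> n1] := cayley_sqr (w0 a a1) (w1 a a1).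
  rewrite ltrDl; apply: divr_gt0; first exact: mulr_gt0.
  by apply: exprn_gt0; exact: lt_le_trans n1.
have M0 : 0 <= M := le_trans (rnorm_ge0 _) (hM a1).
pose Ca := 4 / (1 - rnorm a) ^+ 2.
have Ca0 : 0 < Ca by rewrite divr_gt0// exprn_gt0// subr_gt0.
have circ1 j t : rnorm ((rj j)%:C * cis t : C) < 1.
  by have /andP[r0 r1] := rj_bounds j; rewrite rnorm_circle// ltW.
(* A majorant of |h| |q| ^ (2 m) on the circle of radius rj j. *)
pose G m j t : R := rnorm (h ((rj j)%:C * cis t)) * 9 ^+ m * \1_V t
  + M * (1 + 8 * Re (w ((rj j)%:C * cis t))) ^+ m * \1_(~` V) t.
have bound m : rnorm (h a) * (rnorm (q a) ^+ 2) ^+ m <= Ca * M.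
  have iM : mu.-integrable D (cst (M * 9 ^+ m)%:E).
    exact: (circ_integrable (@cst_continuous _ _ (M * 9 ^+ m))).
  have G_le j t : 0 <= G m j t <= M * 9 ^+ m.
    have := hM (circ1 j t); have := rnorm_ge0 (h ((rj j)%:C * cis t)).
    have := w0 _ (circ1 j t); have := w1 _ (circ1 j t).
    rewrite /G; set u := Re _; set v := rnorm _ => u1 u0 v0 vM.
    have p0 : 0 <= (1 + 8 * u) ^+ m by rewrite exprn_ge0//; lra.
    have p9 : (1 + 8 * u) ^+ m <= 9 ^+ m by rewrite lerXn2r ?nnegrE//; lra.
    have n9 : 0 <= (9 : R) ^+ m by rewrite exprn_ge0.
    rewrite !indicE in_setC; case: (t \in V) => /=; rewrite ?mulr1 ?mulr0 ?addr0 ?add0r.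
      by rewrite mulr_ge0//= ler_wpM2r.
    by rewrite mulr_ge0//= ler_wpM2l.
  have mG j : measurable_fun (D : set (measurableTypeR R)) (fun t => (G m j t)%:E).
    apply: measurable_funTS; apply/measurable_EFinP.
    have cj := rj_bounds j.
    apply: measurable_funD; apply: measurable_funM.
    + apply: continuous_measurable_fun => t; apply: cvgM; last exact: cvg_cst.
      apply: cvg_rnorm; apply: (hol_cvg hh); first exact: circ1.
      exact: continuous_circle.
    + exact: measurable_indic.
    + apply: continuous_measurable_fun => t; apply: cvgM; first exact: cvg_cst.
      have cw : (1 + 8 * Re (w ((rj j)%:C * cis x))) @[x --> t] -->
          1 + 8 * Re (w ((rj j)%:C * cis t)).
        apply: cvgD; first exact: cvg_cst.
        apply: cvgM; first exact: cvg_cst.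
        apply: cvg_Re; apply: (hol_cvg hw); first exact: circ1.
        exact: continuous_circle.
      exact: (cvg_comp _ _ cw (@exprn_continuous _ m _)).
    + by apply: measurable_indic; exact: measurableC.
  have lim : (\int[mu]_(t in D) (G m j t)%:E)%E @[j --> \oo] -->
      (\int[mu]_(t in D) (M * \1_(~` V) t)%:E)%E.
    apply: (dominated_cvg _ _ _ _ iM) => //.
    - move=> t /=; rewrite in_itv/= => /andP[t0 t1].
      suff Gt : G m j t @[j --> \oo] --> M * \1_(~` V) t.
        by apply: cvg_EFin; [exact: nearW|exact: Gt].
      have [Vt|nVt] := pselect (V t).
        have v1 : \1_V t = 1 :> R by rewrite indicE mem_set.
        have v2 : \1_(~` V) t = 0 :> R by rewrite indicE memNset.
        rewrite (_ : (fun j => G m j t) =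
            (fun j => rnorm (h ((rj j)%:C * cis t)) * 9 ^+ m)).
          have cN := cvg_rnorm _ (hV Vt); rewrite rnorm0 in cN.
          by rewrite v2 mulr0 -(mul0r (9 ^+ m)); apply: cvgM; [exact: cN|exact: cvg_cst].
        by apply/funext => j; rewrite /G v1 v2 mulr1 mulr0 addr0.
      have v1 : \1_V t = 0 :> R by rewrite indicE memNset.
      have v2 : \1_(~` V) t = 1 :> R by rewrite indicE mem_set.
      rewrite (_ : (fun j => G m j t) =
          (fun j => M * (1 + 8 * Re (w ((rj j)%:C * cis t))) ^+ m)); last first.
        by apply/funext => j; rewrite /G v1 v2 mulr1 mulr0 add0r.
      have wt : Re (w (r%:C * cis t)) @[r --> (1 : R)^'-] --> (0 : R).
        apply: Re_herglotz_cvg0 => // s Vs; rewrite subr_eq0; apply/eqP => st.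
        have := VD Vs; rewrite /= in_itv/= => /andP[s0 s1].
        by apply: nVt; rewrite -(cis_inj s0 s1 t0 t1 st).
      have wj := cvg_comp _ _ cvg_rj wt.
      have w8 : (1 + 8 * Re (w ((rj j)%:C * cis t))) @[j --> \oo] --> (1 + 8 * 0 : R).
        apply: cvgD; first exact: cvg_cst.
        by apply: cvgM; [exact: cvg_cst|exact: wj].
      have wX := cvg_comp _ _ w8 (@exprn_continuous _ m _).
      rewrite v2 -[X in _ * X](expr1n _ m) -[X in X ^+ m](addr0 1) -(mulr0 8).
      by apply: cvgM; [exact: cvg_cst|exact: wX].
    - by move=> j t _; rewrite /= ger0_norm ?lee_fin; case/andP: (G_le j t).
  have Gbound j : rnorm a + (1 - rnorm a) / 2 < rj j ->
      ((2 * pi * (rnorm (h a) * (rnorm (q a) ^+ 2) ^+ m))%:E <=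
       Ca%:E * \int[mu]_(t in D) (G m j t)%:E)%E.
    move=> rja; have /andP[r0 r1] := rj_bounds j; have a0 := rnorm_ge0 a.
    have arj : rnorm a < rj j by apply: lt_trans rja; rewrite ltrDl divr_gt0// subr_gt0.
    have [P hP] := hol_exp (2 * m) hq.
    have hF := hol_mul hh hP.
    have cF : continuous (fun t =>
        rnorm (h ((rj j)%:C * cis t) * q ((rj j)%:C * cis t) ^+ (2 * m))).
      move=> t; apply: cvg_rnorm; apply: (hol_cvg hF); first exact: circ1.
      exact: continuous_circle.
    have cP : continuous (fun t =>
        rnorm (h ((rj j)%:C * cis t) * q ((rj j)%:C * cis t) ^+ (2 * m)) *
        poisson (rj j) a t).
      by move=> t; apply: cvgM; [exact: cF|exact: continuous_poisson].
    have := poisson_ineq hF r0 r1 arj.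
    rewrite -lee_fin circE// rnormM rnormX exprM => /le_trans; apply.
    rewrite -ge0_integralZl_EFin ?(ltW Ca0)//; last first.
      by move=> t _; rewrite lee_fin; case/andP: (G_le j t).
    apply: ge0_le_integral => //.
    - by move=> t _; rewrite lee_fin mulr_ge0 ?rnorm_ge0// poisson_ge0.
    - by apply: measurable_funTS; apply/measurable_EFinP; exact: continuous_measurable_fun.
    - exact: measurable_funeM.
    - move=> t _; rewrite -EFinM lee_fin mulrC.
      apply: ler_pM; [exact: poisson_ge0|exact: rnorm_ge0| |].
        exact: poisson_bound.
      rewrite rnormM rnormX exprM.
      have := q2 _ (circ1 j t); have := q9 _ (circ1 j t); have := w0 _ (circ1 j t).
      have := hM (circ1 j t); have := rnorm_ge0 (h ((rj j)%:C * cis t)).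
      rewrite /G; set u := Re _; set v := rnorm (h _); set x := rnorm (q _) ^+ 2.
      move=> v0 vM u0 x9 xu; have xx : 0 <= x by exact: sqr_ge0.
      rewrite !indicE in_setC; case: (t \in V) => /=; rewrite ?mulr1 ?mulr0 ?addr0 ?add0r.
        by rewrite ler_wpM2l// lerXn2r ?nnegrE.
      apply: ler_pM => //; first exact: exprn_ge0.
      by rewrite lerXn2r ?nnegrE//; lra.
  have cL : (Ca%:E * \int[mu]_(t in D) (G m j t)%:E)%E @[j --> \oo] -->
      (Ca%:E * \int[mu]_(t in D) (M * \1_(~` V) t)%:E)%E.
    by apply: cvgeZl.
  have h1 : ((2 * pi * (rnorm (h a) * (rnorm (q a) ^+ 2) ^+ m))%:E <=
      Ca%:E * \int[mu]_(t in D) (M * \1_(~` V) t)%:E)%E.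
    rewrite -(cvg_lim _ cL)//; apply: lime_ge; first by apply/cvg_ex; eexists; exact: cL.
    near=> j; apply: Gbound; near: j; apply: near_onem_inv.
    by move: a1; lra.
  have h2 : (\int[mu]_(t in D) (M * \1_(~` V) t)%:E <= (M * (2 * pi))%:E)%E.
    rewrite -circ_cst circE; last exact: cst_continuous.
    apply: ge0_le_integral => //.
    - by move=> t _; rewrite lee_fin mulr_ge0.
    - apply: measurable_funTS; apply/measurable_EFinP; apply: measurable_funM => //.
      by apply: measurable_indic; exact: measurableC.
    - move=> t _; rewrite lee_fin indicE; case: (t \in _); rewrite ?mulr1 ?mulr0//.
  have h3 := le_trans h1 (lee_wpmul2l (ltW Ca0 : (0 <= Ca%:E)%E) h2).
  move: h3; rewrite -EFinM lee_fin.
  rewrite (_ : Ca * (M * (2 * pi)) = 2 * pi * (Ca * M)); last by ring.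
  by rewrite ler_pM2l// twopi_gt0.
have ha0 : 0 < rnorm (h a) by exact: rnorm_gt0.
pose x := rnorm (q a) ^+ 2 - 1.
have x0 : 0 < x by rewrite subr_gt0.
have B0 : 0 <= Ca * M / (rnorm (h a) * x).
  by apply: divr_ge0; apply: mulr_ge0 => //; exact: ltW.
have := archi_boundP B0; set m := Num.bound _ => mP.
have := bound m; apply/negP; rewrite -ltNge.
apply: (@lt_le_trans _ _ (rnorm (h a) * (m%:R * x))).
  by rewrite mulrCA -ltr_pdivrMr// mulr_gt0.
rewrite ler_wpM2l ?(ltW ha0)//.
have := bernoulli m (ltW x0); rewrite (_ : 1 + x = rnorm (q a) ^+ 2); last first.
  by rewrite /x addrC subrK.
by apply: le_trans; rewrite lerDr.
Unshelve. all: by end_near. Qed.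

End CompactZeros.

Let small (k n : nat) : set R :=
  [set t | rnorm (h ((rj n)%:C * cis t)) < k.+1%:R^-1].

Let zeros : set R := `]0, 2 * pi[%classic `&`
  \bigcap_k \bigcup_N \bigcap_(n in [set n | (N <= n)%N]) small k n.

Let zeros_cvg t : zeros t -> h ((rj j)%:C * cis t) @[j --> \oo] --> (0 : C).
Proof.
move=> [_ zt]; apply/cvg_rnormP => e e0.
have [k ke] := ex_invS_lt e0.
have [N _ NP] := zt k I; exists N => // n Nn.
by rewrite /= subr0 (lt_trans _ ke)//; exact: NP.
Qed.

Let cvg_zeros t : 0 < t -> t < 2 * pi ->
  h ((rj j)%:C * cis t) @[j --> \oo] --> (0 : C) -> zeros t.
Proof.
move=> t0 t1 ht; split; first by rewrite /= in_itv/= t0.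
move=> k _; have k0 : 0 < k.+1%:R^-1 :> R by rewrite invr_gt0.
have [N _ NP] := (cvg_rnormP _ _ _).1 ht _ k0.
by exists N => // n Nn; have := NP n Nn; rewrite /= subr0.
Qed.

Let measurable_zeros : measurable (zeros : set (measurableTypeR R)).
Proof.
apply: measurableI; first exact: measurable_itv.
apply: bigcapT_measurable => k; apply: bigcupT_measurable => N.
apply: bigcap_measurable; first by exists N => /=.
move=> n _; apply: open_measurable; rewrite /small.
have /andP[r0 r1] := rj_bounds n.
apply: (@open_comp _ _ (fun t => rnorm (h ((rj n)%:C * cis t)))
  [set x | x < k.+1%:R^-1]) => //.
move=> t _; apply: cvg_rnorm; apply: (hol_cvg hh); last exact: continuous_circle.
by rewrite rnorm_circle// ltW.
Qed.

(** The uniqueness theorem of F. and M. Riesz for boundary values, reduced to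
    compact sets by the inner regularity of the Lebesgue measure. *)
Lemma radial_nonzero :
  ae_circle (fun z => ~ (h (r%:C * z) @[r --> (1 : R)^'-] --> (0 : C))).
Proof.
have zeros0 : mu zeros = 0%E.
  apply/eqP; rewrite eq_le measure_ge0 andbT.
  rewrite lebesgue_regularity_inner_sup//; apply: ge_ereal_sup => _ [K [cK Kz] <-].
  have K0 : mu K = 0%E.
    by apply: compact_zeros_null => // t /Kz => [[]|/zeros_cvg].
  by rewrite /= K0.
rewrite /ae_circle /almost_everywhere.
apply: (@negligibleS _ _ _ mu ([set 0] `|` ([set 2 * pi] `|` zeros))).
  move=> t /= /not_implyP[]; rewrite in_itv/= => /andP[t0 t1] /contrapT ht.
  have [t0'|t0'] := eqVneq t 0; first by left.
  have [t1'|t1'] := eqVneq t (2 * pi); first by right; left.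
  right; right; apply: cvg_zeros.
  - by rewrite lt_neqAle eq_sym t0'.
  - by rewrite lt_neqAle t1'.
  - exact: (cvg_comp _ _ cvg_rj ht).
apply: negligibleU; first exact: negligible_set1.
apply: negligibleU; first exact: negligible_set1.
exact/negligibleP.
Qed.

End Uniqueness.

(** * Vanishing wedge products *)

Section WedgeZero.
Variables (R : realType) (E : hilbertType R) (T : tensorSquare E).
Implicit Types x y : E.

(** The flip is unitary, so symmetric and antisymmetric tensors are
    orthogonal. *)
Lemma wedgeE x y : wedge T x y = 2^-1 *: (tens T x y - tens T y x).
Proof.
set p := 2^-1 *: _; set u := tens T x y.
have Vp : @wedge2 R E T p.
  by rewrite /wedge2 /= /p linearZ/= linearB/= !tens_flipE -scalerN opprB.
have upE : u - p = 2^-1 *: (tens T x y + tens T y x).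
  have {1}-> : u = 2^-1 *: (u + u).
    by rewrite -(mulr2n u) -(scaler_nat _ u) scalerA mulVf ?scale1r// pnatr_eq0.
  by rewrite /p -scalerBr opprB [X in _ *: X]addrC -addrA addKr addrC.
have sym : tens_flip T (u - p) = u - p.
  by rewrite upE linearZ/= linearD/= !tens_flipE addrC.
have orth v : @wedge2 R E T v -> '[u - p, v] = 0.
  rewrite /wedge2 /= => Vv.
  have : '[u - p, v] = - '[u - p, v].
    by rewrite -{1}(tens_flip_dot (u - p) v) sym Vv linearNr.
  by move=> /eqP; rewrite -addr_eq0 -mulr2n mulrn_eq0/= => /eqP.
rewrite /wedge /orth_proj; apply: xget_unique => // q [Vq orthq].
apply/eqP; rewrite -subr_eq0; apply/eqP/rnorm0_eq0.
have Vqp : @wedge2 R E T (q - p).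
  by rewrite /wedge2 /= linearB/= Vq Vp opprB opprK addrC.
have : '[q - p, q - p] = 0.
  rewrite [X in '[X, _]](_ : q - p = (u - p) - (u - q)); last first.
    by rewrite opprB [RHS]addrC addrA subrK.
  have oq : '[u - q, q - p] = 0 by exact: orthq.
  by rewrite dotBl orth// oq subrr.
rewrite dotxx => /(congr1 (@complex.Re R)) /= /eqP.
by rewrite sqrf_eq0 => /eqP.
Qed.

(** The square norm of wedge T x y is the defect in the Cauchy-Schwarz
    inequality, so x and y are parallel when it vanishes. In this form, without
    division by the norm of x, the relation passes to limits. *)
Lemma wedge0_parallel x y : wedge T x y = 0 ->
  (rnorm x ^+ 2)%:C *: y = '[y, x] *: x.
Proof.
rewrite wedgeE => /eqP; rewrite scaler_eq0 invr_eq0 pnatr_eq0/= => /eqP t0.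
apply/eqP; rewrite -subr_eq0; apply/eqP/rnorm0_eq0/eqP.
rewrite -sqrf_eq0 cauchy_schwarz_defect mulf_eq0; apply/orP; right.
have : '[tens T x y - tens T y x, tens T x y] = 0 by rewrite t0 dot0l.
rewrite dotBl !tens_dot !dotxx (dotC x y) -!mulrA [conjc _ * _]mulrC mul_conjc.
rewrite -mulrBr => /eqP; rewrite mulf_eq0 pnatr_eq0/= -real_complexM -real_complexB.
by rewrite real_complex_eq0 [rnorm x ^+ 2]expr2 -mulrA.
Qed.

End WedgeZero.

(** * Kernel of the creation operator *)

Section HardyBounds.
Variables (R : realType) (E : hilbertType R).
Local Notation C := R[i].

Lemma H2_msq (f : C -> E) Q : hol 1 f Q -> H2 f ->
  exists B : R, forall r, 0 < r -> r < 1 -> msq f r <= B.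
Proof.
move=> hf [_]; set S := ereal_sup _ => Soo.
have mean2E r : 0 < r -> r < 1 -> mean2 f r = (Num.sqrt ((2 * pi)^-1 * msq f r))%:E.
  move=> r0 r1; rewrite /mean2 -circE; last first.
    by apply: (continuous_sqr_rnorm_circle hf) => //; exact: ltW.
  rewrite -EFinM poweR_EFin powR12_sqrt// mulr_ge0 ?invr_ge0 ?msq_ge0//.
  by rewrite ltW// twopi_gt0.
have up r : 0 < r -> r < 1 -> (mean2 f r <= S)%E.
  by move=> r0 r1; apply: ereal_sup_ubound; exists r => //=; rewrite in_itv/= r0.
have [s Ss] : exists s : R, S = s%:E.
  have h2 : 2^-1 < 1 :> R by rewrite invf_lt1// ltr1n.
  have h0 : 0 < 2^-1 :> R by rewrite invr_gt0.
  have := up _ h0 h2; rewrite mean2E//.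
  by move: Soo; case: (S) => // s _ _; exists s.
exists (2 * pi * s ^+ 2) => r r0 r1.
have := up r r0 r1; rewrite mean2E// Ss lee_fin => rs.
have s0 : 0 <= s by apply: le_trans rs; exact: sqrtr_ge0.
rewrite -ler_pdivrMl ?twopi_gt0//.
have m0 : 0 <= (2 * pi)^-1 * msq f r.
  by rewrite mulr_ge0 ?invr_ge0 ?msq_ge0// ltW// twopi_gt0.
by rewrite -(sqr_sqrtr m0) lerXn2r ?nnegrE// sqrtr_ge0.
Qed.

Lemma Hinfty_msq (f : C -> E) Q (M : R) : hol 1 f Q ->
  (forall z, disc z -> rnorm (f z) <= M) ->
  forall r, 0 < r -> r < 1 -> msq f r <= M ^+ 2 * (2 * pi).
Proof.
move=> hf fM r r0 r1; rewrite -circ_cst; apply: le_circ.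
- by apply: (continuous_sqr_rnorm_circle hf) => //; exact: ltW.
- exact: cst_continuous.
- move=> t _ _; have fz : rnorm (f (r%:C * cis t)) <= M.
    by apply: fM; apply: disc_cis => //; exact: ltW.
  by rewrite lerXn2r ?nnegrE ?rnorm_ge0// (le_trans (rnorm_ge0 _) fz).
Qed.

End HardyBounds.

Lemma ae_circleW2 (R : realType) (P Q S : R[i] -> Prop) :
  ae_circle P -> ae_circle Q ->
  (forall t : R, P (cis t) -> Q (cis t) -> S (cis t)) ->
  ae_circle S.
Proof.
move=> aP aQ PQS; apply: negligibleS (negligibleU aP aQ) => t /= /not_implyP[tI nSt].
have [Pt|nPt] := pselect (P (cis t)); last by left => /(_ tI).
by right => /(_ tI) Qt; apply: nSt; exact: PQS.
Qed.

Theorem proposition4p12 (R : realType) (E : hilbertType R)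
  (E_separable : separable E) (T : tensorSquare E) (xi : R[i] -> E)
  (xi_Hinfty : Hinfty xi)
  (xi_neq0 : exists2 z, disc z & xi z <> 0) :
  [set radial_lim f | f in creation_ker T xi]
    `<=` PLS [set radial_lim xi] (H2_circle E).
Proof.
move=> _ [f [fH2 fxi] <-].
have [Qf hf] := analytic_hol fH2.1.
have [Qx hx] := analytic_hol xi_Hinfty.1.
have [M xM] := xi_Hinfty.2.
have [B fB] := H2_msq hf fH2.
have limf := fatou hf fB.
have limx := fatou hx (Hinfty_msq hx xM).
have [z0 dz0 xz0] := xi_neq0.
split.
  by exists f => //; apply: ae_circleW2 limf limf _ => t ct _.
(* The component of xi along xi z0 is a bounded scalar holomorphic function
   that does not vanish at z0, so xi has nonzero radial limits. *)
have hh := hol_dot (xi z0) hx.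
have hhM z : rnorm z < 1 -> rnorm '[xi z, xi z0] <= M * rnorm (xi z0).
  move=> z1; rewrite (le_trans (cauchy_schwarz _ _))//.
  by rewrite ler_wpM2r ?rnorm_ge0//; apply: xM; apply/discE.
have hh0 : '[xi z0, xi z0] <> 0.
  rewrite dotxx => /(congr1 (@complex.Re R)) /= /eqP; rewrite sqrf_eq0 => /eqP.
  by move=> /rnorm0_eq0.
have nz := radial_nonzero hh hhM ((discE z0).1 dz0) hh0.
have nzx : ae_circle (fun z => cvg (xi (r%:C * z) @[r --> (1 : R)^'-]) /\
    radial_lim xi z <> 0).
  apply: ae_circleW2 limx nz _ => t ct nt; split=> // x0; apply: nt.
  have xt : xi (r%:C * cis t) @[r --> (1 : R)^'-] --> radial_lim xi (cis t).
    exact: ct.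
  rewrite x0 in xt; rewrite -(dot0l (xi z0)).
  by apply: cvg_dot; [exact: xt|exact: cvg_cst].
apply: ae_circleW2 limf nzx _ => t cf [cx x0].
set x := radial_lim xi (cis t) in x0 *; set y := radial_lim f (cis t).
have xt : xi (r%:C * cis t) @[r --> (1 : R)^'-] --> x by exact: cx.
have yt : f (r%:C * cis t) @[r --> (1 : R)^'-] --> y by exact: cf.
have xy : (rnorm x ^+ 2)%:C *: y = '[y, x] *: x.
  pose L r := (rnorm (xi (r%:C * cis t)) ^+ 2)%:C *: f (r%:C * cis t).
  have L1 : L r @[r --> (1 : R)^'-] --> (rnorm x ^+ 2)%:C *: y.
    have n1 := cvg_rnorm _ xt.
    have n2 : rnorm (xi (r%:C * cis t)) ^+ 2 @[r --> (1 : R)^'-] --> rnorm x ^+ 2.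
      by apply: cvgM; exact: n1.
    apply: cvgZ; last exact: yt.
    exact: (cvg_comp _ _ n2 (@continuous_real_complex R _)).
  have L2 : L r @[r --> (1 : R)^'-] --> '[y, x] *: x.
    have L3 : '[f (r%:C * cis t), xi (r%:C * cis t)] *: xi (r%:C * cis t)
        @[r --> (1 : R)^'-] --> '[y, x] *: x.
      by apply: cvgZ; [apply: cvg_dot; [exact: yt|exact: xt]|exact: xt].
    apply: cvg_trans L3; apply: near_eq_cvg; near=> r.
    apply/esym/wedge0_parallel/fxi; apply: disc_cis.
      by apply: ltW; near: r; exact: nbhs_left_gt.
    by near: r; exact: nbhs_left_lt.
  exact: (cvg_unique _ L1 L2).
exists 1%N, (fun=> '[y, x] / (rnorm x ^+ 2)%:C), (fun=> x); split.
  by move=> _; exists (radial_lim xi).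
rewrite big_ord1 mulrC -scalerA -xy scalerA mulVf ?scale1r//.
by rewrite real_complex_eq0 expf_neq0// gt_eqF// rnorm_gt0.
Unshelve. all: by end_near. Qed.
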